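(* Let $\vec v$ be a periodic billiard direction in the regular pentagon billiard table $D$. For any choice of midpoint $m_J$ of a side $J\in\{1,2,3,4,5\}$ of $D$, the following process determines whether the billiard trajectory through $m_J$ in the direction of $\vec v$ is long, short, or hits a corner point (is a saddle connection). Step 1. Find the tree word $a=k_1k_2\cdots k_n$ associated with $P^{-1}\vec v$, i.e. the finite word with letters $k_j\in\{0,1,2,3\}$ such that $$P^{-1}\vec v=\ell\,\sigma_{k_n}\cdots\sigma_{k_2}\sigma_{k_1}\begin{pmatrix}1\\0\end{pmatrix}\quad\text{for some length }\ell.$$ Step 2. Compute the product $$\tau:=\tau_{k_1}\cdot\tau_{k_2}\cdots\tau_{k_n}\in S_5,$$ where permutations are composed from right to left (and the empty product is the identity). Step 3. Then: (i) if $\tau(J)\in\{1,2\}$, the trajectory is short; (ii) if $\tau(J)\in\{3,4\}$, the trajectory is long; (iii) if $\tau(J)=5$, the trajectory is a saddle connection (it hits a corner point).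
   Context: Let $\phi=\frac{1+\sqrt5}{2}$, and $$P=\begin{pmatrix}1&\cos(\pi/5)\\0&\sin(\pi/5)\end{pmatrix},\quad \sigma_0=\begin{pmatrix}1&\phi\\0&1\end{pmatrix},\ \sigma_1=\begin{pmatrix}\phi&\phi\\1&\phi\end{pmatrix},\ \sigma_2=\begin{pmatrix}\phi&1\\\phi&\phi\end{pmatrix},\ \sigma_3=\begin{pmatrix}1&0\\\phi&1\end{pmatrix}.$$ In the symmetric group $S_5$ put $\tau_0=(1\,2)(3\,4)$, $\tau_1=(1\,3)(2\,5)$, $\tau_2=(1\,4)(3\,5)$, $\tau_3=(2\,3)(4\,5)$. Pentagon: $D$ is a regular pentagon whose bottom side is horizontal. Its sides are labeled $1$ (upper left), $2$ (upper right), $3$ (lower left), $4$ (lower right), $5$ (bottom), and $m_J$ is the midpoint of side $J$. Concretely, one may take $D$ to have vertices $P(\phi,0)^T,\ P(\phi^2,0)^T,\ P(\phi,\phi)^T,\ P(0,\phi^2)^T,\ P(0,\phi)^T$. Double pentagon: the translation surface obtained from $D$ and a copy of $-D$ (the image of $D$ under rotation by $\pi$) by gluing each side of $D$ by translation to the parallel side of $-D$. The vertices give the cone point. Side midpoints of $D$ are points of this surface. Golden L: the translation surface obtained from a $\phi\times\phi$ square by gluing two $1\times\phi$ rectangles to adjacent sides (the top and the right side) and identifying opposite parallel sides by translation. The matrix $P$ takes the golden L to the double pentagon, and a direction $\vec v$ is periodic on the double pentagon if and only if $P^{-1}\vec v$ is periodic on the golden L. The matrices $\sigma_0,\dots,\sigma_3$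 generate the Veech group of the golden L. The tree word of a periodic direction vector on the golden L is supplied by a theorem of Davis and Lelièvre, which is stated for first-quadrant vectors: to any periodic direction vector $\vec w$ in the first quadrant on the golden L corresponds a unique sequence $(k_1,\dots,k_n)$ with $\vec w=\ell\,\sigma_{k_n}\cdots\sigma_{k_1}(1,0)^T$ for some length $\ell$. Unfolding: reflecting the table instead of the trajectory turns a billiard trajectory in $D$ through $m_J$ in direction $\vec v$ into the straight-line trajectory on the double pentagon through $m_J$ with direction $\vec v$. Periodic direction: a direction in which the double pentagon has a closed straight-line trajectory avoiding the cone point. A cylinder in a periodic direction is a maximal family of parallel closed straight-line trajectories in that direction; its boundary consists of saddle connections, i.e. straight segments joining cone points with no cone point in the interior. In every periodic direction the double pentagon decomposes into exactly two cylinders, and the ratio of their circumferences is $\phi$; they are called the long and the short cylinder. The billiard trajectory through $m_J$ in a periodic direction $\vec v$ is called long (respectively short) if the corresponding straight-line trajectory on the double pentagon lies in the long (respectively short) cylinder in direction $\vec v$. It is called a saddle connection (equivalently, it hits a corner) if the corresponding straight-line trajectory lies on a saddle connection in direction $\vec v$. *)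

(* Defs.v *)
From HB Require Import structures.
From mathcomp Require Import all_boot all_order all_algebra all_fingroup.
From mathcomp Require Import boolp classical_sets reals trigo.

Set Implicit Arguments.
Unset Strict Implicit.
Unset Printing Implicit Defensive.

Import Order.TTheory GRing.Theory Num.Theory.
Local Open Scope ring_scope.
Local Open Scope classical_set_scope.

Definition vec2 (R : realType) (x y : R) : 'cV[R]_2 :=
  \col_(i < 2) (if i == 0 then x else y).

Definition mx2 (R : realType) (a b c d : R) : 'M[R]_2 :=
  \matrix_(i < 2, j < 2)
    (if i == 0 then (if j == 0 then a else b) else (if j == 0 then c else d)).

Definition enorm (R : realType) (v : 'cV[R]_2) : R :=
  Num.sqrt (v 0 0 ^+ 2 + v 1 0 ^+ 2).

Definition phi (R : realType) : R := (1 + Num.sqrt 5) / 2.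

Definition matP (R : realType) : 'M[R]_2 :=
  mx2 1 (cos (pi / 5)) 0 (sin (pi / 5)).

Definition sigma (R : realType) (k : 'I_4) : 'M[R]_2 :=
  let f := phi R in
  match val k with
  | 0%N => mx2 1 f 0 1
  | 1%N => mx2 f f 1 f
  | 2%N => mx2 f 1 f f
  | _ => mx2 1 0 f 1
  end.

(* [:: k_1; ...; k_n] is sent to sigma_{k_n} ... sigma_{k_1} (1,0)^T. *)
Definition tree_vector (R : realType) (a : seq 'I_4) : 'cV[R]_2 :=
  foldl (fun w k => sigma R k *m w) (vec2 1 0) a.

Definition tree_word (R : realType) (a : seq 'I_4) (w : 'cV[R]_2) : Prop :=
  exists2 l : R, 0 < l & w = l *: tree_vector R a.

(* The label k in {1, ..., 5} is the element k - 1 of 'I_5. *)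
Definition lbl (k : nat) : 'I_5 := inord k.-1.

Definition tau (k : 'I_4) : 'S_5 :=
  match val k with
  | 0%N => tperm (lbl 1) (lbl 2) * tperm (lbl 3) (lbl 4)
  | 1%N => tperm (lbl 1) (lbl 3) * tperm (lbl 2) (lbl 5)
  | 2%N => tperm (lbl 1) (lbl 4) * tperm (lbl 3) (lbl 5)
  | _ => tperm (lbl 2) (lbl 3) * tperm (lbl 4) (lbl 5)
  end%g.

(* (s * t)%g applies s first, so this is the right-to-left composite
   J |-> tau_{k_1} (tau_{k_2} (... (tau_{k_n} J))). *)
Definition tau_word (a : seq 'I_4) : 'S_5 :=
  foldr (fun k s => s * tau k)%g 1%g a.

(* Vertices of D in counterclockwise order, from the left end of the bottom
   side. *)
Definition vertex (R : realType) (i : 'I_5) : 'cV[R]_2 :=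
  let f := phi R in
  matP R *m match val i with
            | 0%N => vec2 f 0
            | 1%N => vec2 (f ^+ 2) 0
            | 2%N => vec2 f f
            | 3%N => vec2 0 (f ^+ 2)
            | _ => vec2 0 f
            end.

(* Ends of the side with a given label: 1 upper left, 2 upper right,
   3 lower left, 4 lower right, 5 bottom. *)
Definition side_ends (R : realType) (J : 'I_5) : 'cV[R]_2 * 'cV[R]_2 :=
  let V (k : nat) := vertex R (inord k) in
  match (val J).+1 with
  | 1%N => (V 3, V 4)%N
  | 2%N => (V 2, V 3)%N
  | 3%N => (V 4, V 0)%N
  | 4%N => (V 1, V 2)%N
  | _ => (V 0, V 1)%N
  end.

Definition side (R : realType) (J : 'I_5) : set 'cV[R]_2 :=
  [set x | exists t : R, 0 <= t <= 1 /\
     x = (1 - t) *: (side_ends R J).1 + t *: (side_ends R J).2].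

Definition midpoint (R : realType) (J : 'I_5) : 'cV[R]_2 :=
  2^-1 *: ((side_ends R J).1 + (side_ends R J).2).

Definition pentagon (R : realType) : set 'cV[R]_2 :=
  [set x | exists w : 'I_5 -> R,
     [/\ forall i, 0 <= w i, \sum_i w i = 1 & x = \sum_i w i *: vertex R i]].

(* A point of the double pentagon is represented by a sheet (false for D,
   true for -D) and a position in that pentagon. A point interior to a side
   has two representatives, related by [glued]; all vertices of both
   pentagons represent the cone point. *)
Definition pt (R : realType) : Type := (bool * 'cV[R]_2)%type.

Definition polygon (R : realType) (b : bool) : set 'cV[R]_2 :=
  [set x | pentagon ((-1) ^+ b *: x)].

Definition cone (R : realType) (p : pt R) : Prop :=
  exists i : 'I_5, p.2 = (-1) ^+ p.1 *: vertex R i.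

(* The side J of D and the side -J of -D differ by translation by -2 m_J. *)
Definition glued (R : realType) (p q : pt R) : Prop :=
  exists (J : 'I_5) (x : 'cV[R]_2), side J x /\
    let y := x - 2 *: midpoint R J in
    (p = (false, x) /\ q = (true, y)) \/ (p = (true, y) /\ q = (false, x)).

(* [straight_path v p t q]: a straight segment with displacement t v leads
   from p to q and has no cone point in its interior. It is a finite chain of
   chords of the two convex pentagons, successive chords being joined across a
   side at a point that is not a cone point; the end points may be cone points.
   A nondegenerate chord cannot have a vertex in its interior. A zero-length
   path identifies the representatives of a point. *)
Inductive straight_path (R : realType) (v : 'cV[R]_2) :
    pt R -> R -> pt R -> Prop :=
| path_chord (b : bool) (x : 'cV[R]_2) (t : R) :
    0 <= t -> polygon b x -> polygon b (x + t *: v) ->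
    straight_path v (b, x) t (b, x + t *: v)
| path_cross (p q q' r : pt R) (s t : R) :
    straight_path v p s q -> ~ cone q -> glued q q' ->
    straight_path v q' t r -> straight_path v p (s + t) r.

Definition on_path (R : realType) (v : 'cV[R]_2) (p : pt R) (t : R) (q : pt R) :
    set (pt R) :=
  [set r | exists s : R,
     [/\ 0 <= s <= t, straight_path v p s r & straight_path v r (t - s) q]].

(* The straight-line trajectory through p, stopped at the cone point if it
   meets it. *)
Definition trajectory (R : realType) (v : 'cV[R]_2) (p : pt R) : set (pt R) :=
  [set q | ~ cone q /\
     exists t : R, straight_path v p t q \/ straight_path v q t p].

Definition closed_at (R : realType) (v : 'cV[R]_2) (p : pt R) : Prop :=
  ~ cone p /\ exists2 T : R, 0 < T & straight_path v p T p.

Definition periodic_direction (R : realType) (v : 'cV[R]_2) : Prop :=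
  v != 0 /\ exists p : pt R, closed_at v p.

(* A family of parallel closed trajectories, as the set of points it covers.
   The last clause says that it is in one piece: any two of its points are
   joined by a straight segment (in some direction h) within the family. *)
Record parallel_family (R : realType) (v : 'cV[R]_2) (C : set (pt R)) : Prop :=
  ParallelFamily {
    family_nonempty : C !=set0;
    family_closed : forall p, C p -> closed_at v p;
    family_trajectory : forall p, C p -> trajectory v p `<=` C;
    family_connected : forall p q, C p -> C q ->
      exists h : 'cV[R]_2, straight_path h p 1 q /\ on_path h p 1 q `<=` C
  }.

Definition cylinder (R : realType) (v : 'cV[R]_2) (C : set (pt R)) : Prop :=
  parallel_family v C /\
  forall C', parallel_family v C' -> C `<=` C' -> C' = C.

Definition least_period (R : realType) (v : 'cV[R]_2) (p : pt R) (T : R) :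
    Prop :=
  [/\ 0 < T, straight_path v p T p &
      forall T', 0 < T' -> straight_path v p T' p -> T <= T'].

(* The common length c of the closed trajectories in the cylinder. *)
Definition circumference (R : realType) (v : 'cV[R]_2) (C : set (pt R))
    (c : R) : Prop :=
  forall p, C p -> exists2 T, least_period v p T & c = T * enorm v.

Definition long_short_cylinders (R : realType) (v : 'cV[R]_2)
    (C1 C2 : set (pt R)) : Prop :=
  [/\ cylinder v C1, cylinder v C2,
      forall C, cylinder v C -> C = C1 \/ C = C2 &
      exists c : R, circumference v C1 (phi R * c) /\ circumference v C2 c].

Definition long_trajectory (R : realType) (v : 'cV[R]_2) (p : pt R) : Prop :=
  exists C1 C2, long_short_cylinders v C1 C2 /\ trajectory v p `<=` C1.

Definition short_trajectory (R : realType) (v : 'cV[R]_2) (p : pt R) : Prop :=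
  exists C1 C2, long_short_cylinders v C1 C2 /\ trajectory v p `<=` C2.

Definition saddle_connection (R : realType) (v : 'cV[R]_2) (S : set (pt R)) :
    Prop :=
  exists (p q : pt R) (T : R),
    [/\ cone p, cone q, 0 < T, straight_path v p T q & S = on_path v p T q].

Definition saddle_trajectory (R : realType) (v : 'cV[R]_2) (p : pt R) : Prop :=
  exists S, saddle_connection v S /\ trajectory v p `<=` S.

(* The billiard trajectory through m_J in direction v unfolds to the
   straight-line trajectory with the same direction through this point. *)
Definition side_midpoint (R : realType) (J : 'I_5) : pt R :=
  (false, midpoint R J).

(* Main.v *)
From HB Require Import structures.
From mathcomp Require Import all_boot all_order all_algebra all_fingroup.
From mathcomp Require Import boolp classical_sets reals trigo.
From mathcomp Require Import ring lra.
Require Import Defs.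

Set Implicit Arguments.
Unset Strict Implicit.
Unset Printing Implicit Defensive.

Import Order.TTheory GRing.Theory Num.Theory.
Local Open Scope ring_scope.
Local Open Scope classical_set_scope.

(** The affine automorphisms of the double pentagon undo every tree word, one
    letter at a time.

    In the direction (1, 0) of the empty word the answer can be read off
    ([horizontal_fate]): the horizontal diagonal cuts the surface into the long
    cylinder, made of the two trapezoids and containing m_3 and m_4, and the
    short one, made of the two triangles and containing m_1 and m_2, while m_5
    lies on a horizontal saddle connection.

    A letter k multiplies the direction by sigma_k, and sigma_k = T rho^k,
    where T = sigma_0 and rho is the rotation by pi / 5 read in the basis of P
    ([sigma_twist_rot]).  Both P rho P^-1 and P T P^-1 are derivatives of affine
    automorphisms of the surface: the rotation of each pentagon by pi / 5 about
    its centre, which turns D into -D and conversely ([rot_iso]), and the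
    simultaneous Dehn twist of the two horizontal cylinders, which exists
    because they have the same modulus, phi in the basis of P ([twist_iso]).  An affine automorphism carries cylinders to
    cylinders and saddle connections to saddle connections, and it multiplies
    all lengths in a given direction by one factor; hence it carries long,
    short and saddle trajectories to trajectories of the same kind
    ([fate_image]).  It permutes the side midpoints of D, and T rho^k permutes
    them by tau_k ([tau_sides]).  Induction on the word concludes.

    The substance is that the twist maps straight paths to straight paths.  A
    closed horizontal cylinder is unfolded into a horizontal strip of the plane
    tiled by copies of its two pieces ([develops]).  Straight paths at the
    heights of the open cylinder and straight segments of the open strip are the
    same thing ([strip_path], [strip_lift]), and on the strip the twist is a
    linear shear.  A chord of a pentagon is cut where it crosses the horizontal
    diagonal, and each piece is sheared in its strip ([twist_path]).

    Cone points need care: a representative of the cone point stands for one of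
    its sectors, and an affine map may send one sector across several.
    Automorphisms are therefore relations between points other than the cone
    point, and a path that ends at the cone point is only required to have an
    image that ends at some representative of it.  That this is enough rests on
    the determinism of straight paths ([path_continue]) and on the fact that
    they cannot pass through the cone point ([path_stops_at_cone]). *)

(** * The pentagon in the basis of P *)

Section Coordinates.
Variable R : realType.
Local Notation f := (phi R).

Lemma phi_sq : f * f = f + 1.
Proof.
rewrite /phi; have := @sqr_sqrtr R 5 ltac:(lra).
by move: (Num.sqrt 5) => s; rewrite expr2 => h; lra.
Qed.

Lemma phi_bounds : 8 / 5 < f < 5 / 3.
Proof.
have s0 := @sqrtr_ge0 R 5; have := @sqr_sqrtr R 5 ltac:(lra).
by rewrite /phi; move: (Num.sqrt 5) s0 => s s0; rewrite expr2 => h; nra.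
Qed.

Lemma phi_gt0 : 0 < f. Proof. have := phi_bounds; lra. Qed.

Definition dir (x y : R) : 'cV[R]_2 := matP R *m vec2 x y.

Definition sg (b : bool) : R := (-1) ^+ b.

Lemma sgN b : sg (~~ b) = - sg b.
Proof. by case: b; rewrite /sg /= ?expr1 ?expr0 ?opprK. Qed.

Lemma sgsg b : sg b * sg b = 1.
Proof. by case: b; rewrite /sg /= ?expr1 ?expr0; lra. Qed.

(** Both sheets are read as copies of D, by applying the rotation by pi to the
    points of -D. Gluing then reflects D in the midpoint of a side, and moving in
    direction w on the sheet b displaces the coordinates by [sg b] times w. *)
Definition chart (b : bool) (x y : R) : pt R := (b, sg b *: dir x y).

Lemma cV2P (u v : 'cV[R]_2) : u 0 0 = v 0 0 -> u 1 0 = v 1 0 -> u = v.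
Proof.
move=> h0 h1; apply/colP => -[[|[|//]] i].
  by rewrite (_ : Ordinal i = 0) //; apply/val_inj.
by rewrite (_ : Ordinal i = 1) //; apply/val_inj.
Qed.

Lemma vec2D (a b c d : R) : vec2 a b + vec2 c d = vec2 (a + c) (b + d).
Proof. by apply: cV2P; rewrite !mxE. Qed.

Lemma vec2Z (l a b : R) : l *: vec2 a b = vec2 (l * a) (l * b).
Proof. by apply: cV2P; rewrite !mxE. Qed.

Lemma vec2_surj (u : 'cV[R]_2) : u = vec2 (u 0 0) (u 1 0).
Proof. by apply: cV2P; rewrite !mxE. Qed.

Lemma mx2_vec2 (a b c d x y : R) :
  mx2 a b c d *m vec2 x y = vec2 (a * x + b * y) (c * x + d * y).
Proof. by apply: cV2P; rewrite !mxE !big_ord_recl big_ord0 !mxE /= addr0. Qed.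

Lemma sin_pi5_gt0 : 0 < sin (pi / 5 : R).
Proof. by apply: sin_gt0_pi; have := pi_gt0 R; lra. Qed.

Lemma mx2_mul (a b c d a' b' c' d' : R) :
  mx2 a b c d *m mx2 a' b' c' d' =
  mx2 (a * a' + b * c') (a * b' + b * d') (c * a' + d * c') (c * b' + d * d').
Proof.
apply/matrixP => -[[|[|//]] i] -[[|[|//]] j];
  by rewrite !mxE !big_ord_recl big_ord0 !mxE /= addr0.
Qed.

Lemma mx2_1 : mx2 1 0 0 1 = 1%:M :> 'M[R]_2.
Proof.
by apply/matrixP => -[[|[|//]] i] -[[|[|//]] j]; rewrite !mxE.
Qed.

Lemma matP_unit : matP R \in unitmx.
Proof.
have s0 := sin_pi5_gt0.
suff h : matP R *m mx2 1 (- cos (pi / 5) / sin (pi / 5)) 0 (sin (pi / 5))^-1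
         = 1%:M by case: (mulmx1_unit h).
by rewrite /matP mx2_mul -mx2_1; congr mx2; field; lra.
Qed.

Lemma dirD a b c d : dir a b + dir c d = dir (a + c) (b + d).
Proof. by rewrite /dir -mulmxDr vec2D. Qed.

Lemma dirZ l a b : l *: dir a b = dir (l * a) (l * b).
Proof. by rewrite /dir scalemxAr vec2Z. Qed.

Lemma dirN a b : - dir a b = dir (- a) (- b).
Proof. by rewrite -scaleN1r dirZ !mulN1r. Qed.

Lemma dir_inj a b c d : dir a b = dir c d -> a = c /\ b = d.
Proof.
move=> /(congr1 (mulmx (invmx (matP R)))); rewrite !(mulKmx matP_unit) => h.
split; first by move: (congr1 (fun v : 'cV_2 => v 0 0) h); rewrite !mxE.
by move: (congr1 (fun v : 'cV_2 => v 1 0) h); rewrite !mxE.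
Qed.

Lemma dir_surj v : exists a b, v = dir a b.
Proof.
have := vec2_surj (invmx (matP R) *m v); set a := (_ 0 0); set b := (_ 1 0) => h.
by exists a, b; rewrite /dir -h mulKVmx // matP_unit.
Qed.

Lemma dir00 : dir 0 0 = 0.
Proof. by have := dirZ 0 0 0; rewrite !mul0r scale0r. Qed.

Lemma chart_inj b x y b' x' y' :
  chart b x y = chart b' x' y' -> [/\ b = b', x = x' & y = y'].
Proof.
move=> [<-] /(congr1 ( *:%R (sg b))); rewrite !scalerA sgsg !scale1r.
by move=> /dir_inj [-> ->].
Qed.

Lemma chart_surj p : exists b x y, p = chart b x y.
Proof.
case: p => b v; have [x [y h]] := dir_surj (sg b *: v).
by exists b, x, y; rewrite /chart -h scalerA sgsg scale1r.
Qed.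

(** The affine functions vanishing on the five sides, normalised so that the
    rotation of D of order five permutes them exactly ([rot_slack]). *)
Definition slack (J : 'I_5) (x y : R) : R :=
  match val J with
  | 0%N => x
  | 1%N => 2 * f + 1 - x - f * y
  | 2%N => f * x + f * y - f - 1
  | 3%N => 2 * f + 1 - f * x - y
  | _ => y
  end.

(** The linear part of [slack]. *)
Definition slope (J : 'I_5) (x y : R) : R :=
  match val J with
  | 0%N => x
  | 1%N => - x - f * y
  | 2%N => f * x + f * y
  | 3%N => - f * x - y
  | _ => y
  end.

Lemma valK5 k : (k < 5)%N -> val (inord k : 'I_5) = k.
Proof. exact: inordK. Qed.

Lemma ord5_ind (Q : 'I_5 -> Prop) :
  Q (lbl 1) -> Q (lbl 2) -> Q (lbl 3) -> Q (lbl 4) -> Q (lbl 5) ->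
  forall J, Q J.
Proof.
move=> h1 h2 h3 h4 h5 [[|[|[|[|[|//]]]]] i].
- by rewrite (_ : Ordinal i = lbl 1) //; apply: ord_inj; rewrite /lbl inordK.
- by rewrite (_ : Ordinal i = lbl 2) //; apply: ord_inj; rewrite /lbl inordK.
- by rewrite (_ : Ordinal i = lbl 3) //; apply: ord_inj; rewrite /lbl inordK.
- by rewrite (_ : Ordinal i = lbl 4) //; apply: ord_inj; rewrite /lbl inordK.
- by rewrite (_ : Ordinal i = lbl 5) //; apply: ord_inj; rewrite /lbl inordK.
Qed.

Lemma slack1 x y : slack (lbl 1) x y = x. Proof. by rewrite /slack /lbl valK5. Qed.
Lemma slack2 x y : slack (lbl 2) x y = 2 * f + 1 - x - f * y.
Proof. by rewrite /slack /lbl valK5. Qed.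
Lemma slack3 x y : slack (lbl 3) x y = f * x + f * y - f - 1.
Proof. by rewrite /slack /lbl valK5. Qed.
Lemma slack4 x y : slack (lbl 4) x y = 2 * f + 1 - f * x - y.
Proof. by rewrite /slack /lbl valK5. Qed.
Lemma slack5 x y : slack (lbl 5) x y = y. Proof. by rewrite /slack /lbl valK5. Qed.
Definition slackE := (slack1, slack2, slack3, slack4, slack5).

Lemma slackD J x y x' y' : slack J (x + x') (y + y') = slack J x y + slope J x' y'.
Proof. by rewrite /slack /slope; case: J => -[|[|[|[|?]]]] ? /=; lra. Qed.

Lemma slopeZ J l x y : slope J (l * x) (l * y) = l * slope J x y.
Proof. by rewrite /slope; case: J => -[|[|[|[|?]]]] ? /=; ring. Qed.

Definition inD (x y : R) : Prop := forall J, 0 <= slack J x y.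

Lemma inDP x y : inD x y <->
  [/\ 0 <= x, 0 <= 2 * f + 1 - x - f * y, 0 <= f * x + f * y - f - 1,
      0 <= 2 * f + 1 - f * x - y & 0 <= y].
Proof.
split=> [h|[h1 h2 h3 h4 h5]].
  by split; [have := h (lbl 1) | have := h (lbl 2) | have := h (lbl 3)
    | have := h (lbl 4) | have := h (lbl 5)]; rewrite slackE.
by move=> J; elim/ord5_ind: J; rewrite slackE.
Qed.

(** Coordinates of twice the midpoint of a side: across that side the two copies
    of D are glued by (x, y) |-> (refx - x, refy - y). *)
Definition refx (J : 'I_5) : R :=
  match val J with
  | 0%N => 0 | 1%N => f | 2%N => f | 3%N => 2 * f + 1 | _ => 2 * f + 1
  end.

Definition refy (J : 'I_5) : R :=
  match val J with
  | 0%N => 2 * f + 1 | 1%N => 2 * f + 1 | 2%N => f | 3%N => f | _ => 0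
  end.

Lemma ref1 : (refx (lbl 1) = 0) * (refy (lbl 1) = 2 * f + 1).
Proof. by rewrite /refx /refy /lbl !valK5. Qed.
Lemma ref2 : (refx (lbl 2) = f) * (refy (lbl 2) = 2 * f + 1).
Proof. by rewrite /refx /refy /lbl !valK5. Qed.
Lemma ref3 : (refx (lbl 3) = f) * (refy (lbl 3) = f).
Proof. by rewrite /refx /refy /lbl !valK5. Qed.
Lemma ref4 : (refx (lbl 4) = 2 * f + 1) * (refy (lbl 4) = f).
Proof. by rewrite /refx /refy /lbl !valK5. Qed.
Lemma ref5 : (refx (lbl 5) = 2 * f + 1) * (refy (lbl 5) = 0).
Proof. by rewrite /refx /refy /lbl !valK5. Qed.
Definition refE := (ref1, ref2, ref3, ref4, ref5).

Lemma slack_ref J x y : slack J (refx J - x) (refy J - y) = - slack J x y.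
Proof.
have p2 := phi_sq.
by elim/ord5_ind: J; rewrite !slackE !refE; lra.
Qed.

Lemma vertex0 : vertex R (inord 0) = dir f 0. Proof. by rewrite /vertex valK5. Qed.
Lemma vertex1 : vertex R (inord 1) = dir (f ^+ 2) 0. Proof. by rewrite /vertex valK5. Qed.
Lemma vertex2 : vertex R (inord 2) = dir f f. Proof. by rewrite /vertex valK5. Qed.
Lemma vertex3 : vertex R (inord 3) = dir 0 (f ^+ 2). Proof. by rewrite /vertex valK5. Qed.
Lemma vertex4 : vertex R (inord 4) = dir 0 f. Proof. by rewrite /vertex valK5. Qed.
Definition vertexE := (vertex0, vertex1, vertex2, vertex3, vertex4).

Lemma side_ends1 : side_ends R (lbl 1) = (dir 0 (f ^+ 2), dir 0 f).
Proof. by rewrite /side_ends /lbl valK5 //= !vertexE. Qed.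
Lemma side_ends2 : side_ends R (lbl 2) = (dir f f, dir 0 (f ^+ 2)).
Proof. by rewrite /side_ends /lbl valK5 //= !vertexE. Qed.
Lemma side_ends3 : side_ends R (lbl 3) = (dir 0 f, dir f 0).
Proof. by rewrite /side_ends /lbl valK5 //= !vertexE. Qed.
Lemma side_ends4 : side_ends R (lbl 4) = (dir (f ^+ 2) 0, dir f f).
Proof. by rewrite /side_ends /lbl valK5 //= !vertexE. Qed.
Lemma side_ends5 : side_ends R (lbl 5) = (dir f 0, dir (f ^+ 2) 0).
Proof. by rewrite /side_ends /lbl valK5 //= !vertexE. Qed.
Definition side_endsE :=
  (side_ends1, side_ends2, side_ends3, side_ends4, side_ends5).

Lemma midpointE J : midpoint R J = dir (refx J / 2) (refy J / 2).
Proof.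
have p2 := phi_sq.
by elim/ord5_ind: J; rewrite /midpoint side_endsE !refE dirD dirZ;
  congr dir; rewrite ?expr2 ?p2; lra.
Qed.

Lemma side_slack J x y : side J (dir x y) <-> inD x y /\ slack J x y = 0.
Proof.
have p2 := phi_sq; have pb := phi_bounds; have p0 := phi_gt0.
have key k : 0 <= k <= 1 -> 0 <= f * k <= f.
  by case/andP=> k0 k1; rewrite mulr_ge0 ?(ltW p0) //= ger_pMr.
split=> [[t [/[dup] t01 /key ft]]|].
  have tff : t * (f * f) = t * f + t by rewrite p2; lra.
  elim/ord5_ind: J; rewrite side_endsE /= !dirZ dirD => /dir_inj [-> ->];
    rewrite slackE inDP ?expr2 ?p2; (split; [split|]); lra.
case=> /inDP [h1 h2 h3 h4 h5].
elim/ord5_ind: J; rewrite slackE => e.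
- exists (f + 1 - y); rewrite side_endsE /= !dirZ dirD expr2 p2.
  split; [nra | by congr dir; nra].
- exists (y - f); rewrite side_endsE /= !dirZ dirD expr2 p2.
  split; [nra | by congr dir; nra].
- have ey : y = f - x by nra.
  exists (x * (f - 1)); rewrite side_endsE /= !dirZ dirD ey.
  split; [nra | by congr dir; nra].
- exists (y * (f - 1)); rewrite side_endsE /= !dirZ dirD expr2 p2.
  have ex : x = f + 1 - (f - 1) * y by nra.
  split; [nra | by congr dir; rewrite ?ex; nra].
- exists (x - f); rewrite side_endsE /= !dirZ dirD expr2 p2.
  split; [nra | by congr dir; nra].
Qed.

Lemma sum5 (V : zmodType) (F : 'I_5 -> V) :
  \sum_i F i = F (inord 0) + F (inord 1) + F (inord 2) + F (inord 3) + F (inord 4).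
Proof.
rewrite !big_ord_recl big_ord0 addr0 !addrA.
by congr (_ + _ + _ + _ + _); congr F; apply/val_inj; rewrite /= inordK.
Qed.

Lemma pentagon_inD x y : pentagon (dir x y) <-> inD x y.
Proof.
have p2 := phi_sq; have pb := phi_bounds; have p0 := phi_gt0.
have kk k : 0 <= k -> 0 <= f * k by move=> ?; rewrite mulr_ge0 ?(ltW p0).
split=> [[w [w0]]|].
  rewrite !sum5 !vertexE !dirZ !dirD expr2 p2.
  have := (w0 (inord 0), w0 (inord 1), w0 (inord 2), w0 (inord 3), w0 (inord 4)).
  move: (w (inord 0)) (w (inord 1)) (w (inord 2)) (w (inord 3)) (w (inord 4)).
  move=> a b c d e.
  move=> [[[[a0 b0] c0] d0] e0] s /dir_inj [-> ->].
  have fa := kk a a0; have fb := kk b b0; have fc := kk c c0.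
  have fd := kk d d0; have fe := kk e e0.
  have eq1 : f = f * (a + b + c + d + e) by rewrite s mulr1.
  by rewrite inDP; split; nra.
case/inDP => h1 h2 h3 h4 h5.
suff [a [b [c [d [e [[a0 b0 c0 d0 e0] s ex ey]]]]]] :
    exists a b c d e : R, [/\ [/\ 0 <= a, 0 <= b, 0 <= c, 0 <= d & 0 <= e],
     a + b + c + d + e = 1, x = a * f + b * (f + 1) + c * f &
     y = c * f + d * (f + 1) + e * f].
  exists (fun i => match val i with
                   | 0%N => a | 1%N => b | 2%N => c | 3%N => d | _ => e end).
  split; first by move=> -[[|[|[|[|?]]]] ?].
    by rewrite sum5 !valK5.
  by rewrite sum5 !valK5 // !vertexE !dirZ !dirD expr2 p2 ex ey; congr dir; ring.
have [yf|yf] := lerP y f; last first.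
  exists 0, 0, ((f - 1) * x), (y - f), (1 - (f - 1) * x - (y - f)).
  split; [split | | |]; nra.
(* The horizontal chord at height y runs between points dividing sides 3 and 4
   in the ratio l, and (x, y) divides that chord in the ratio m. *)
pose l := y * (f - 1).
have wd : 0 < 1 + (f - 1) * l by rewrite /l; nra.
pose m := (x - f + y) / (1 + (f - 1) * l).
have ml : m * (1 + (f - 1) * l) = x - f + y by rewrite /m divfK // gt_eqF.
have xl : 0 <= x - f + y by nra.
have m0 : 0 <= m by rewrite /m divr_ge0 // ltW.
have m1 : m <= 1.
  by rewrite /m ler_pdivrMr // mul1r /l; nra.
have l0 : 0 <= l <= 1 by rewrite /l; nra.
have ey : y = f * l by rewrite /l; nra.
clearbody m l.
exists ((1 - l) * (1 - m)), ((1 - l) * m), (l * m), 0, (l * (1 - m)).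
split; [split; rewrite ?mulr_ge0 //; lra | by ring | | by rewrite ey; ring].
have -> : x = f - y + m * (1 + (f - 1) * l) by rewrite ml; lra.
by rewrite ey; ring.
Qed.

Lemma sgZZ b (v : 'cV[R]_2) : sg b *: (sg b *: v) = v.
Proof. by rewrite scalerA sgsg scale1r. Qed.

Lemma polygon_chart b x y : polygon b (sg b *: dir x y) <-> inD x y.
Proof. by rewrite -pentagon_inD /polygon /= -/(sg b) sgZZ. Qed.

(** The vertices of D, characterised by two active inequalities: this form is
    stable under the symmetries of D and gives extremality at once. *)
Definition corner x y : Prop :=
  inD x y /\ exists J K, [/\ J != K, slack J x y = 0 & slack K x y = 0].

Lemma corner_cases x y : corner x y <->
  (x, y) \in [:: (f, 0); (f + 1, 0); (f, f); (0, f + 1); (0, f)].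
Proof.
have p2 := phi_sq; have pb := phi_bounds; have p0 := phi_gt0.
rewrite !inE !xpair_eqE; split; last first.
{ case/orP=> [|/orP[|/orP[|/orP[|]]]] /andP[/eqP -> /eqP ->].
  all: rewrite /corner inDP; split; first by split; nra.
  - by exists (lbl 3), (lbl 5); split; rewrite ?slackE -?val_eqE /= ?inordK //; nra.
  - by exists (lbl 4), (lbl 5); split; rewrite ?slackE -?val_eqE /= ?inordK //; nra.
  - by exists (lbl 2), (lbl 4); split; rewrite ?slackE -?val_eqE /= ?inordK //; nra.
  - by exists (lbl 1), (lbl 2); split; rewrite ?slackE -?val_eqE /= ?inordK //; nra.
  - by exists (lbl 1), (lbl 3); split; rewrite ?slackE -?val_eqE /= ?inordK //; nra. }
case=> /inDP [h1 h2 h3 h4 h5] [J [K []]].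
have fx : f * (f * x) = f * x + x by rewrite mulrA p2; lra.
have fy : f * (f * y) = f * y + y by rewrite mulrA p2; lra.
elim/ord5_ind: J; elim/ord5_ind: K; rewrite -?val_eqE /lbl ?valK5 //= => _.
all: rewrite -!/(lbl _) !slackE => e1 e2.
all: have e1' := congr1 ( *%R f) e1; have e2' := congr1 ( *%R f) e2.
all: try (exfalso; lra).
all: try (have [-> ->] : x = f /\ y = 0 by [split; lra]); try by rewrite !eqxx ?orbT.
all: try (have [-> ->] : x = f + 1 /\ y = 0 by [split; lra]); try by rewrite !eqxx ?orbT.
all: try (have [-> ->] : x = f /\ y = f by [split; lra]); try by rewrite !eqxx ?orbT.
all: try (have [-> ->] : x = 0 /\ y = f + 1 by [split; lra]); try by rewrite !eqxx ?orbT.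
all: try (have [-> ->] : x = 0 /\ y = f by [split; lra]); try by rewrite !eqxx ?orbT.
Qed.
End Coordinates.

(** * The surface in coordinates *)

Section Gluing.
Variable R : realType.
Local Notation f := (phi R).
Implicit Types (p q r : pt R) (b : bool) (J : 'I_5) (x y s t : R) (v : 'cV[R]_2).

Lemma inD_ref J x y : inD x y -> slack J x y = 0 -> inD (refx R J - x) (refy R J - y).
Proof.
have p2 := phi_sq R; have pb := phi_bounds R.
move=> /inDP [h1 h2 h3 h4 h5] e; rewrite inDP.
have fx : f * (f * x) = f * x + x by rewrite mulrA p2; lra.
have fy : f * (f * y) = f * y + y by rewrite mulrA p2; lra.
have e' := congr1 ( *%R f) e; move: e e'.
by elim/ord5_ind: J; rewrite slackE !refE => e e'; split; lra.
Qed.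

Lemma corner_ref J x y : corner x y -> slack J x y = 0 ->
  corner (refx R J - x) (refy R J - y).
Proof.
have p2 := phi_sq R; have pb := phi_bounds R.
have ff : f * f = f + 1 by [].
move/corner_cases; rewrite !inE !xpair_eqE => h e; apply/corner_cases.
rewrite !inE !xpair_eqE; move: e.
case/orP: h => [|/orP[|/orP[|/orP[|]]]] /andP[/eqP -> /eqP ->].
all: elim/ord5_ind: J; rewrite slackE !refE => e.
all: try (exfalso; lra).
all: try by rewrite ?subrr ?subr0 ?eqxx ?orbT.
all: do ?[rewrite (_ : 2 * f + 1 - (f + 1) = f); last by lra].
all: do ?[rewrite (_ : 2 * f + 1 - f = f + 1); last by lra].
all: by rewrite ?subrr ?subr0 ?eqxx ?orbT.
Qed.

Lemma sgZ_inj b (u v : 'cV[R]_2) : sg R b *: u = sg R b *: v -> u = v.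
Proof. by move=> /(congr1 ( *:%R (sg R b))); rewrite !sgZZ. Qed.

Lemma cone_chart b x y : cone (chart b x y) <-> corner x y.
Proof.
rewrite corner_cases !inE !xpair_eqE /cone /=; split.
  case=> i /sgZ_inj; rewrite /vertex -!/(dir _ _).
  by case: i => -[|[|[|[|?]]]] ? /= /dir_inj[-> ->]; rewrite ?expr2 ?phi_sq !eqxx ?orbT.
case/orP=> [|/orP[|/orP[|/orP[|]]]] /andP[/eqP -> /eqP ->].
- by exists (inord 0); rewrite vertexE.
- by exists (inord 1); rewrite vertexE expr2 phi_sq.
- by exists (inord 2); rewrite vertexE.
- by exists (inord 3); rewrite vertexE expr2 phi_sq.
- by exists (inord 4); rewrite vertexE.
Qed.

Lemma chartF x y : (false, dir x y) = chart false x y.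
Proof. by rewrite /chart /sg /= expr0 scale1r. Qed.

Lemma chartT x y : (true, dir x y) = chart true (- x) (- y).
Proof. by rewrite /chart /sg /= expr1 dirZ !mulN1r !opprK. Qed.

Lemma glued_chart b x y q : glued (chart b x y) q <->
  exists J, [/\ inD x y, slack J x y = 0 &
                q = chart (~~ b) (refx R J - x) (refy R J - y)].
Proof.
have mE J : 2 *: midpoint R J = dir (refx R J) (refy R J).
  by rewrite midpointE dirZ; congr dir; lra.
have dirB a c a' c' : dir a c - dir a' c' = dir (a - a') (c - c') :> 'cV[R]_2.
  by rewrite -scaleN1r dirZ dirD; congr dir; lra.
split=> [[J [u [sJ /= h]]]|[J [D e ->]]].
  have [a [c ea]] := dir_surj u; rewrite {}ea mE dirB in sJ h.
  have [Dac sl] := (side_slack J a c).1 sJ.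
  move: h; rewrite chartF chartT !opprB => -[[/chart_inj [-> -> ->]] ->|].
    by exists J.
  case=> /chart_inj [-> -> ->] ->; exists J; split.
  - exact: inD_ref.
  - by rewrite slack_ref sl oppr0.
  - by congr chart; lra.
exists J; case: b.
- exists (dir (refx R J - x) (refy R J - y)); split.
    by apply/side_slack; split; [apply: inD_ref | rewrite slack_ref e oppr0].
  by right; rewrite mE dirB chartF chartT; split=> //; congr chart; lra.
- exists (dir x y); split; first exact/side_slack.
  by left; rewrite mE dirB chartF chartT; split=> //; congr chart; lra.
Qed.

Lemma glued_sym p q : glued p q -> glued q p.
Proof. by move=> [J [u [s [[-> ->]|[-> ->]]]]]; exists J, u; split; auto. Qed.

Lemma glued_cone p q : glued p q -> cone p -> cone q.
Proof.
have [b [x [y ->]]] := chart_surj p.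
move=> /glued_chart [J [D e ->]] /cone_chart c.
exact/cone_chart/corner_ref.
Qed.

Lemma chord b wx wy x y t : 0 <= t -> inD x y ->
  inD (x + t * (sg R b * wx)) (y + t * (sg R b * wy)) ->
  straight_path (dir wx wy) (chart b x y) t
    (chart b (x + t * (sg R b * wx)) (y + t * (sg R b * wy))).
Proof.
move=> t0 D0 D1; have e : sg R b *: dir (x + t * (sg R b * wx)) (y + t * (sg R b * wy))
    = sg R b *: dir x y + t *: dir wx wy.
  rewrite -dirD scalerDr !dirZ; congr (_ + dir _ _).
    by rewrite mulrCA mulrA mulrA -(mulrA t) sgsg mulr1.
  by rewrite mulrCA mulrA mulrA -(mulrA t) sgsg mulr1.
rewrite /chart e; apply: path_chord => //; first exact/polygon_chart.
by rewrite -e; apply/polygon_chart.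
Qed.

(** Induction on straight paths with chords in coordinates: it removes [matP] and
    the sheet signs from all later arguments. *)
Lemma path_chart_ind wx wy (Q : pt R -> R -> pt R -> Prop) :
  (forall b x y t, 0 <= t -> inD x y ->
     inD (x + t * (sg R b * wx)) (y + t * (sg R b * wy)) ->
     Q (chart b x y) t (chart b (x + t * (sg R b * wx)) (y + t * (sg R b * wy)))) ->
  (forall p q q' r s t, straight_path (dir wx wy) p s q -> Q p s q -> ~ cone q ->
     glued q q' -> straight_path (dir wx wy) q' t r -> Q q' t r -> Q p (s + t) r) ->
  forall p t q, straight_path (dir wx wy) p t q -> Q p t q.
Proof.
move=> hc hx p t q; elim=> [b u {}t t0|]; last by move=> ? ? ? ? ? ?; apply: hx.
have [b' [x [y [<- e]]]] := chart_surj (b, u); rewrite {b'}e.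
have e : sg R b *: dir x y + t *: dir wx wy
   = sg R b *: dir (x + t * (sg R b * wx)) (y + t * (sg R b * wy)).
  rewrite -dirD scalerDr !dirZ; congr (_ + dir _ _).
    by rewrite mulrCA mulrA mulrA -(mulrA t) sgsg mulr1.
  by rewrite mulrCA mulrA mulrA -(mulrA t) sgsg mulr1.
by rewrite e => /polygon_chart D0 /polygon_chart D1; apply: hc.
Qed.

End Gluing.

(** * Straight paths and their determinism *)

Section Paths.
Variable R : realType.
Local Notation f := (phi R).
Implicit Types (p q r : pt R) (b : bool) (J : 'I_5) (x y s t : R) (v : 'cV[R]_2).

Definition valid p := exists b x y, p = chart b x y /\ inD x y.

Definition regular p := valid p /\ ~ cone p.

(** Two representatives of one point of the surface; the representatives of the
    cone point are kept apart, as they stand for different sectors. *)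
Definition same p q := p = q \/ (~ cone p /\ glued p q).

Lemma slack_step J x y t e wx wy :
  slack J (x + t * (e * wx)) (y + t * (e * wy)) =
  slack J x y + t * (e * slope J wx wy).
Proof. by rewrite slackD !slopeZ. Qed.

Lemma inD_between x y t e wx wy s : inD x y ->
  inD (x + t * (e * wx)) (y + t * (e * wy)) -> 0 <= s <= t ->
  inD (x + s * (e * wx)) (y + s * (e * wy)).
Proof.
move=> D0 D1 /andP[s0 st] J; move: (D0 J) (D1 J); rewrite !slack_step => h0 h1.
have [d0|d0] := lerP 0 (e * slope J wx wy); first by rewrite addr_ge0 // mulr_ge0.
have : t * (e * slope J wx wy) <= s * (e * slope J wx wy) by rewrite ler_nM2r.
lra.
Qed.

Lemma slope_indep J K wx wy : J != K -> slope J wx wy = 0 :> R ->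
  slope K wx wy = 0 -> wx = 0 /\ wy = 0.
Proof.
have p2 := phi_sq R; have pb := phi_bounds R.
have ux : f * (f * wx) = f * wx + wx by rewrite mulrA p2; lra.
have uy : f * (f * wy) = f * wy + wy by rewrite mulrA p2; lra.
elim/ord5_ind: J; elim/ord5_ind: K; rewrite -?val_eqE /slope /lbl ?valK5 //= => _.
all: move=> e1 e2; have e1' := congr1 ( *%R f) e1; have e2' := congr1 ( *%R f) e2.
all: split; lra.
Qed.

(** A nonnegative affine function that vanishes inside a segment is constant on
    it. *)
Lemma chord_pinch J x y t e wx wy s : inD x y ->
  inD (x + t * (e * wx)) (y + t * (e * wy)) -> 0 < s < t ->
  slack J (x + s * (e * wx)) (y + s * (e * wy)) = 0 -> e * slope J wx wy = 0.
Proof.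
move=> /(_ J) D0 /(_ J) + /andP[s0 st]; rewrite !slack_step.
move: (e * _) D0 => m D0 D1 E; have [m0|m0|//] := ltgtP m 0.
  have : (t - s) * m < 0 by rewrite nmulr_llt0 // subr_gt0. lra.
have : 0 < s * m by rewrite mulr_gt0. lra.
Qed.

Lemma corner_extreme x y t b wx wy s : inD x y ->
  inD (x + t * (sg R b * wx)) (y + t * (sg R b * wy)) -> 0 < s < t ->
  corner (x + s * (sg R b * wx)) (y + s * (sg R b * wy)) -> wx = 0 /\ wy = 0.
Proof.
move=> D0 D1 st [_ [J [K [JK e1 e2]]]].
have nz m : sg R b * m = 0 -> m = 0 by move=> h; rewrite -[m]mul1r -(sgsg R b) -mulrA h mulr0.
by apply: (slope_indep JK); apply: nz; [apply: chord_pinch e1 | apply: chord_pinch e2].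
Qed.

(** Seen from the two sheets, the same direction enters D on one and leaves it on
    the other, so nondegenerate chords in both can only run along the side. *)
Lemma twin_slope b J x y s t wx wy : slack J x y = 0 ->
  inD (x + s * (sg R b * wx)) (y + s * (sg R b * wy)) ->
  inD (refx R J - x + t * (sg R (~~ b) * wx)) (refy R J - y + t * (sg R (~~ b) * wy)) ->
  0 < s -> 0 < t -> sg R b * slope J wx wy = 0.
Proof.
move=> e /(_ J) + /(_ J); rewrite !slack_step slack_ref e sgN => h1 h2 s0 t0.
apply: le_anti; apply/andP; split.
  by rewrite -oppr_ge0 -mulNr -(pmulr_rge0 _ t0); lra.
by rewrite -(pmulr_rge0 _ s0); lra.
Qed.

Lemma regular_side b x y J K : ~ cone (chart b x y) -> inD x y ->
  slack J x y = 0 -> slack K x y = 0 -> J = K.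
Proof.
move=> n D e1 e2; apply/eqP/negP => /negP JK; apply: n; apply/cone_chart.
by split=> //; exists J, K.
Qed.

Lemma same_refl p : same p p. Proof. by left. Qed.

Lemma same_sym p q : same p q -> same q p.
Proof.
case=> [->|[n g]]; first exact: same_refl.
right; split; last exact: glued_sym.
by move=> /(glued_cone (glued_sym g)).
Qed.

Lemma same_cone p q : same p q -> cone p -> cone q.
Proof. by case=> [->|[]]. Qed.

(** Transitivity holds because a point other than a vertex lies on one side only. *)
Lemma same_trans p q r : same p q -> same q r -> same p r.
Proof.
case=> [->//|[n g]] [<-|[n' g']]; first by right.
left; have [b [x [y E]]] := chart_surj p; move: n g; rewrite {}E => n.
case/glued_chart=> J [D e E]; move: n' g'; rewrite {}E => n'.
case/glued_chart=> K [D' e' ->]; rewrite negbK.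
have <- : J = K by apply: (regular_side n' D' _ e'); rewrite slack_ref e oppr0.
by congr chart; lra.
Qed.

Lemma path_ge0 v p t q : straight_path v p t q -> 0 <= t.
Proof. by elim=> // *; rewrite addr_ge0. Qed.

Lemma path_valid v p t q : straight_path v p t q -> valid p /\ valid q.
Proof.
have [wx [wy ->]] := dir_surj v; elim/path_chart_ind.
  move=> b x y {}t t0 D0 D1; split; first by exists b, x, y.
  by exists b, (x + t * (sg R b * wx)), (y + t * (sg R b * wy)).
by move=> *; split; tauto.
Qed.

Lemma path_refl v p : valid p -> straight_path v p 0 p.
Proof.
have [wx [wy ->]] := dir_surj v; move=> [b [x [y [-> D]]]].
have := @chord R b wx wy x y 0 (lexx 0) D; rewrite !mul0r !addr0; exact.
Qed.

(** The first path ends, and the second begins, with a chord of the same pentagon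
    in the same direction; convexity merges them, even at a vertex. *)
Lemma path_cat v p s q t r :
  straight_path v p s q -> straight_path v q t r -> straight_path v p (s + t) r.
Proof.
move=> h1 h2; elim: h2 p s h1 => {q t r}; last first.
  move=> q q1 q1' r s t _ IH n g h _ p s' h1.
  by rewrite addrA; apply: path_cross n g h; apply: IH.
move=> b x t t0 D0 D1 p s h.
have [q eq] : exists q, q = (b, x) by exists (b, x).
rewrite -eq in h; elim: h b x t t0 D0 D1 eq => {p s q}.
  move=> b' x' s s0 D0' D1' b x t t0 D0 D1 [eb ex]; subst b' x.
  rewrite -addrA -scalerDl; apply: path_chord => //; first exact: addr_ge0.
  by rewrite scalerDl addrA.
move=> p q q' r s t h1 _ n g _ IH b x u u0 D0 D1 e.
by rewrite -addrA; apply: path_cross h1 n g _; apply: IH.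
Qed.

Lemma path_same v p q : valid p -> same p q -> straight_path v p 0 q.
Proof.
move=> V [<-|[n g]]; first exact: path_refl.
have V' : valid q.
  case: V g => b [x [y [-> D]]] /glued_chart [J [_ e ->]].
  by do 3!eexists; split; first reflexivity; apply: inD_ref.
by rewrite -(addr0 0); apply: path_cross g _ => //; apply: path_refl.
Qed.

Lemma path_same_l v p q t r :
  same p q -> straight_path v q t r -> straight_path v p t r.
Proof.
move=> /same_sym + h; case=> [<-//|[n g]].
rewrite -(add0r t); apply: path_cross (glued_sym g) (h).
  apply/path_refl; case: (path_valid h) => -[b [x [y [E D]]]] _.
  move: g; rewrite E => /glued_chart [J [_ e ->]].
  by do 3!eexists; split; first reflexivity; apply: inD_ref.
by move=> /(glued_cone (glued_sym g)).
Qed.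

Lemma path_same_r v p t q r :
  straight_path v p t q -> same q r -> straight_path v p t r.
Proof.
move=> h s; rewrite -(addr0 t); apply: path_cat (h) _; apply: path_same s.
by case: (path_valid h).
Qed.

Lemma path_rev v p t q : straight_path v p t q -> straight_path (- v) q t p.
Proof.
elim=> {p t q} [b x t t0 D0 D1|p q q' r s t h1 IH1 n g h2 IH2].
  have := @path_chord R (- v) b (x + t *: v) t t0 D1.
  by rewrite scalerN addrK; apply.
rewrite addrC -(add0r s); apply: path_cat IH2 _.
by rewrite add0r; apply: path_same_l IH1; apply: same_sym; right.
Qed.

(** The displacement t v can vanish for t = 0 or for v = 0; both occur, since the
    segments joining points of a family may be degenerate. *)
Lemma path_null v p t q : straight_path v p t q -> t *: v = 0 -> same p q.
Proof.
elim=> {p t q} [b x t t0 _ _ ->|p q q' r s t h1 IH1 n g h2 IH2 e].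
  by rewrite addr0; left.
have s0 := path_ge0 h1; have t0 := path_ge0 h2.
have {e} [st|v0] : s = 0 /\ t = 0 \/ v = 0.
  move/eqP: e; rewrite scaler_eq0 => /orP[/eqP e|/eqP ->]; [left; lra|by right].
  case: st => s1 t1; apply: same_trans (IH1 _) _; first by rewrite s1 scale0r.
  by apply: same_trans (IH2 _); [right | rewrite t1 scale0r].
apply: same_trans (IH1 _) _; first by rewrite v0 scaler0.
by apply: same_trans (IH2 _); [right | rewrite v0 scaler0].
Qed.

Section Determinism.
Variables wx wy : R.
Local Notation stepx b x t := (x + t * (sg R b * wx)).
Local Notation stepy b y t := (y + t * (sg R b * wy)).

Lemma stepA (x a e s t : R) : x + s * (e * a) + t * (e * a) = x + (s + t) * (e * a).
Proof. lra. Qed.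

(** A path that starts like a chord follows it as long as the chord lasts. The
    start is only known up to [same] because the path may cross to and fro over
    the side that contains it. *)
Lemma chord_prefix p t q : straight_path (dir wx wy) p t q ->
  forall b x y s, inD x y -> inD (stepx b x s) (stepy b y s) ->
    same (chart b x y) p -> t <= s -> ~ cone q ->
    same (chart b (stepx b x t) (stepy b y t)) q.
Proof.
elim/path_chart_ind=> {p t q}.
  move=> b0 x0 y0 t t0 D0 D1 b x y s D D' [/chart_inj [-> -> ->]|[n g]] ts nq.
    exact: same_refl.
  move/glued_chart: g => [J [_ e /chart_inj [eb ex ey]]]; subst b0 x0 y0.
  apply: same_sym; right; split=> //; apply: glued_sym; apply/glued_chart.
  have e' : slack J (stepx b x t) (stepy b y t) = 0.
    rewrite slack_step e add0r; have [->|tn0] := eqVneq t 0; first by rewrite mul0r.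
    have tp : 0 < t by rewrite lt_neqAle eq_sym tn0.
    by rewrite (twin_slope e D' D1) ?mulr0 // (lt_le_trans tp ts).
  exists J; split=> //; first by apply: inD_between D D' _; rewrite t0.
  by rewrite sgN; congr chart; lra.
move=> p q q' r s t h1 IH1 n g h2 IH2 b x y u D D' sm tu nr.
have s0 := path_ge0 h1; have t0 := path_ge0 h2.
have sq := IH1 b x y u D D' sm ltac:(lra) n.
rewrite -!stepA; apply: (IH2 _ _ _ (u - s)) => //.
- by apply: inD_between D D' _; rewrite s0; lra.
- by rewrite !stepA addrCA subrr addr0.
- by apply: same_trans sq _; right.
- lra.
Qed.

(** The chord may end first; what remains of the path then starts at its end. *)
Lemma chord_continue p t r : straight_path (dir wx wy) p t r ->
  forall b x y s, inD x y -> inD (stepx b x s) (stepy b y s) ->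
    same (chart b x y) p -> 0 <= s <= t ->
    ~ cone (chart b (stepx b x s) (stepy b y s)) ->
    straight_path (dir wx wy) (chart b (stepx b x s) (stepy b y s)) (t - s) r.
Proof.
elim/path_chart_ind=> {p t r}.
  move=> b0 x0 y0 t t0 D0 D1 b x y s D D' + /andP[s0 st] nq.
  have ts0 : 0 <= t - s by rewrite subr_ge0.
  case=> [/chart_inj [eb ex ey]|[n g]].
    subst b0 x0 y0; have := @chord R b wx wy _ _ (t - s) ts0 D'.
    by rewrite !stepA addrCA subrr addr0; apply.
  move/glued_chart: g => [J [_ e /chart_inj [eb ex ey]]]; subst b0 x0 y0.
  have e' : slack J (stepx b x s) (stepy b y s) = 0.
    rewrite slack_step e add0r; have [->|sn0] := eqVneq s 0; first by rewrite mul0r.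
    have sp : 0 < s by rewrite lt_neqAle eq_sym sn0.
    by rewrite (twin_slope e D' D1) ?mulr0 // (lt_le_trans sp st).
  have sm : same (chart b (stepx b x s) (stepy b y s))
     (chart (~~ b) (stepx (~~ b) (refx R J - x) s) (stepy (~~ b) (refy R J - y) s)).
    right; split=> //; apply/glued_chart; exists J; split=> //.
    by rewrite sgN; congr chart; lra.
  apply: path_same_l sm _.
  have := @chord R (~~ b) wx wy (stepx (~~ b) (refx R J - x) s)
     (stepy (~~ b) (refy R J - y) s) (t - s) ts0.
  rewrite !stepA addrCA subrr addr0; apply=> //.
  by apply: inD_between D0 D1 _; rewrite s0.
move=> p q q' r s t h1 IH1 n g h2 IH2 b x y u D D' sm /andP[u0 ut] nu.
have s0 := path_ge0 h1; have t0 := path_ge0 h2.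
have [us|su] := lerP u s.
  rewrite (_ : s + t - u = s - u + t); last by lra.
  by apply: path_cross (IH1 _ _ _ _ D D' sm _ nu) n g h2; rewrite u0.
have sq := chord_prefix h1 D D' sm (ltW su) n.
have Ds : inD (stepx b x s) (stepy b y s) by apply: inD_between D D' _; rewrite s0 ltW.
have := IH2 b _ _ (u - s) Ds; rewrite !stepA addrCA subrr addr0.
rewrite (_ : t - (u - s) = s + t - u); last by lra.
by apply=> //; [apply: same_trans sq _; right | lra].
Qed.

(** A vertex at the end of a chord blocks the path: by extremality no chord of
    either sheet goes on in the same direction. *)
Lemma chord_no_cone p t r : straight_path (dir wx wy) p t r ->
  forall b x y s, inD x y -> inD (stepx b x s) (stepy b y s) ->
    same (chart b x y) p -> 0 < s < t ->
    cone (chart b (stepx b x s) (stepy b y s)) -> wx = 0 /\ wy = 0.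
Proof.
elim/path_chart_ind=> {p t r}.
  move=> b0 x0 y0 t t0 D0 D1 b x y s D D' + /[dup] st /andP[s0 ts] /cone_chart c.
  case=> [/chart_inj [eb ex ey]|[n g]].
    by subst b0 x0 y0; exact: corner_extreme D0 D1 st c.
  move/glued_chart: g => [J [_ e /chart_inj [eb ex ey]]]; subst b0 x0 y0.
  have e' : slack J (stepx b x s) (stepy b y s) = 0.
    by rewrite slack_step e add0r (twin_slope e D' D1) ?mulr0 // (lt_trans s0 ts).
  apply: corner_extreme D0 D1 st _; have := corner_ref c e'.
  by rewrite sgN; congr corner; lra.
move=> p q q' r s t h1 IH1 n g h2 IH2 b x y u D D' sm /andP[u0 ut] c.
have s0 := path_ge0 h1; have t0 := path_ge0 h2.
have [us|su] := ltrP u s; first by apply: (IH1 _ _ _ _ D D' sm _ c); rewrite u0.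
have sq := chord_prefix h1 D D' sm su n.
have [es|us] := eqVneq s u; first by case: n; apply: same_cone sq _; rewrite es.
have Ds : inD (stepx b x s) (stepy b y s) by apply: inD_between D D' _; rewrite s0.
have {}us : s < u by rewrite lt_neqAle us.
have := IH2 b _ _ (u - s) Ds; rewrite !stepA addrCA subrr addr0.
by apply=> //; [apply: same_trans sq _; right | lra].
Qed.

End Determinism.

(** Determinism: of two paths with the same start and direction, the longer
    continues the shorter. *)
Lemma path_continue v p s q : straight_path v p s q ->
  forall t r, straight_path v p t r -> s <= t -> ~ cone q ->
  straight_path v q (t - s) r.
Proof.
have [wx [wy ->]] := dir_surj v; elim/path_chart_ind=> {p s q}.
  move=> b x y s s0 D0 D1 t r h st n.
  by apply: (chord_continue h D0 D1 (same_refl _)) => //; rewrite s0.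
move=> p q q' r s t h1 IH1 n g h2 IH2 u z h su nr.
have t0 := path_ge0 h2.
rewrite (_ : u - (s + t) = u - s - t); last by lra.
apply: IH2 => //; last by lra.
by apply: path_same_l (IH1 _ _ h _ n); [apply: same_sym; right | lra].
Qed.

Lemma path_stops_at_cone v p s q t r : straight_path v p s q ->
  straight_path v p t r -> 0 < s < t -> cone q -> v = 0.
Proof.
have [wx [wy ->]] := dir_surj v => h.
elim/path_chart_ind: h t r => {p s q}.
  move=> b x y s s0 D0 D1 t r h st c.
  by have [-> ->] := chord_no_cone h D0 D1 (same_refl _) st c; rewrite dir00.
move=> p q q' r s t h1 _ n g h2 IH2 u z h /andP[s0 su] c.
have s1 := path_ge0 h1; have t0 := path_ge0 h2.
have [e|tn0] := eqVneq t 0.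
  case: n; apply: (glued_cone (glued_sym g)).
  by apply: same_cone c; apply: same_sym; apply: path_null h2 _; rewrite e scale0r.
have tp : 0 < t by rewrite lt_neqAle eq_sym tn0.
apply: (IH2 (u - s) z) => //; last by lra.
apply: path_same_l (path_continue h1 h _ n); first by apply: same_sym; right.
lra.
Qed.

End Paths.

(** * Affine automorphisms transport cylinders and saddle connections *)

Section Transport.
Variable R : realType.
Local Notation f := (phi R).
Implicit Types (p q r : pt R) (b : bool) (J : 'I_5) (x y s t : R) (v : 'cV[R]_2).
Implicit Types (A : 'M[R]_2) (F : pt R -> pt R -> Prop) (C : set (pt R)).

(** Half of an affine automorphism with derivative A. It is a relation, as points
    have several representatives, and it leaves the cone point aside: the sector
    that receives a path ending there depends on the direction of the path. *)
Record carries A F : Prop := Carries {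
  carries_regular : forall p p', F p p' -> regular p /\ regular p';
  carries_total : forall p, regular p -> exists p', F p p';
  carries_path : forall v p t q p' q', straight_path v p t q ->
    F p p' -> F q q' -> straight_path (A *m v) p' t q';
  carries_cone : forall v p t q p', straight_path v p t q -> cone q ->
    F p p' -> exists2 q', cone q' & straight_path (A *m v) p' t q' }.

Definition converse F : pt R -> pt R -> Prop := fun p q => F q p.

Record affine_iso A F : Prop := AffineIso {
  iso_unit : A \in unitmx;
  iso_carries : carries A F;
  iso_carriesV : carries (invmx A) (converse F) }.

Lemma affine_isoV A F : affine_iso A F -> affine_iso (invmx A) (converse F).
Proof. by case=> u c c'; split; rewrite ?unitmx_inv ?invmxK. Qed.

Definition image F C : set (pt R) := [set p' | exists2 p, C p & F p p'].

(** Needed because an image of a path is known to avoid the cone point only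
    through its end points. *)
Lemma between_noncone v p s r t q : ~ cone p -> ~ cone q ->
  straight_path v p s r -> straight_path v r t q -> ~ cone r.
Proof.
move=> np nq h1 h2 c; have s0 := path_ge0 h1; have t0 := path_ge0 h2.
have null u r1 r2 : straight_path v r1 u r2 -> u *: v = 0 -> cone r1 <-> cone r2.
  move=> h e; have sm := path_null h e.
  by split; apply: same_cone => //; apply: same_sym.
have v0 : v != 0.
  by apply/eqP => v0; apply/np/(null _ _ _ h1) => //; rewrite v0 scaler0.
have sp : 0 < s.
  rewrite lt_neqAle s0 andbT eq_sym; apply/eqP => e.
  by apply/np/(null _ _ _ h1) => //; rewrite e scale0r.
have tp : 0 < t.
  rewrite lt_neqAle t0 andbT eq_sym; apply/eqP => e.
  by apply/nq/(null _ _ _ h2) => //; rewrite e scale0r.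
move/eqP: v0; apply; apply: path_stops_at_cone (h1) (path_cat h1 h2) _ c.
by rewrite sp ltrDl.
Qed.

Lemma closed_regular v p : closed_at v p -> regular p.
Proof. by case=> n [T _ h]; split=> //; case: (path_valid h). Qed.

(** By determinism a trajectory that meets the cone point on both sides of p has
    no point outside the saddle connection so found. *)
Lemma saddle_through v a s p u c : v != 0 -> ~ cone p -> cone a -> cone c ->
  straight_path v a s p -> straight_path v p u c -> saddle_trajectory v p.
Proof.
move=> /eqP v0 np ca cc h1 h2.
have pos w t r1 r2 : straight_path w r1 t r2 -> ~ cone r1 -> cone r2 -> 0 < t.
  move=> hp n1 c2; rewrite lt_neqAle (path_ge0 hp) andbT eq_sym; apply/eqP => e.
  apply: n1; apply: same_cone c2; apply: same_sym; apply: path_null hp _.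
  by rewrite e scale0r.
have bound w t r1 r2 s1 r3 : w <> 0 -> straight_path w r1 t r2 -> ~ cone r1 ->
    cone r2 -> straight_path w r1 s1 r3 -> s1 <= t.
  move=> w0 hp n1 c2 hp'; have t0 := pos _ _ _ _ hp n1 c2.
  rewrite leNgt; apply/negP => us; apply: w0.
  by apply: path_stops_at_cone hp hp' _ c2; rewrite t0.
have s0 := path_ge0 h1; have u0 := pos _ _ _ _ h2 np cc.
exists (on_path v a (s + u) c); split.
  exists a, c, (s + u); split=> //; first by rewrite ltr_wpDl.
  exact: path_cat h1 h2.
move=> r [nr [t [ht|ht]]]; have t0 := path_ge0 ht.
- have tb := bound _ _ _ _ _ _ v0 h2 np cc ht.
  exists (s + t); split; [by lra | exact: path_cat h1 ht|].
  rewrite (_ : s + u - (s + t) = u - t); last by lra.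
  exact: path_continue ht _ _ h2 tb nr.
- have nv0 : - v <> 0 by move=> /eqP; rewrite oppr_eq0 => /eqP.
  have tb := bound _ _ _ _ _ _ nv0 (path_rev h1) np ca (path_rev ht).
  exists (s - t); split; [by lra | |].
    rewrite -[v]opprK; apply: path_rev.
    exact: path_continue (path_rev ht) _ _ (path_rev h1) tb nr.
  rewrite (_ : s + u - (s - t) = t + u); last by lra.
  exact: path_cat ht h2.
Qed.

Section Iso.
Variables (A : 'M[R]_2) (F : pt R -> pt R -> Prop).
Hypothesis isoF : affine_iso A F.
Let cF := iso_carries isoF.
Let cFV := iso_carriesV isoF.

Lemma pull_path v p t q p' q' : straight_path (A *m v) p' t q' ->
  F p p' -> F q q' -> straight_path v p t q.
Proof.
move=> h Fp Fq; have := carries_path cFV h Fp Fq.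
by rewrite mulKmx // (iso_unit isoF).
Qed.

Lemma regular_pre p' : regular p' -> exists p, F p p'.
Proof. exact: (carries_total cFV). Qed.

Lemma image_closed v p p' : F p p' -> closed_at v p -> closed_at (A *m v) p'.
Proof.
move=> Fp [n [T T0 h]]; split; first by case: (carries_regular cF Fp) => _ [].
by exists T => //; exact: (carries_path cF h Fp Fp).
Qed.

Lemma image_trajectory v C p p' : F p p' ->
  trajectory v p `<=` C -> trajectory (A *m v) p' `<=` image F C.
Proof.
move=> Fp tC q' [nq [t h]].
have Vq' : valid q' by case: h => /path_valid [].
have [q Fq] := regular_pre (conj Vq' nq); exists q => //; apply: tC; split.
  by case: (carries_regular cF Fq) => -[].
by exists t; case: h => h; [left | right]; apply: pull_path h _ _.
Qed.

Lemma image_family v C : parallel_family v C -> parallel_family (A *m v) (image F C).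
Proof.
case=> [[p0 Cp0] closed traj conn]; split.
- have [p' Fp] := carries_total cF (closed_regular (closed _ Cp0)).
  by exists p', p0.
- by move=> p' [p /closed cl Fp]; apply: image_closed Fp cl.
- by move=> p' [p Cp Fp]; apply: image_trajectory Fp _; apply: traj.
- move=> p' q' [p Cp Fp] [q Cq Fq]; have [h [hp hC]] := conn p q Cp Cq.
  exists (A *m h); split; first exact: (carries_path cF hp Fp Fq).
  move=> r' [s [s01 h1 h2]].
  have [[_ np'] [_ nq']] := ((carries_regular cF Fp).2, (carries_regular cF Fq).2).
  have nr' := between_noncone np' nq' h1 h2.
  have [r Fr] := regular_pre (conj (path_valid h1).2 nr'); exists r => //.
  by apply: hC; exists s; split=> //; [apply: pull_path h1 _ _ | apply: pull_path h2 _ _].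
Qed.

Lemma image_converse v C : parallel_family v C -> image (converse F) (image F C) = C.
Proof.
case=> _ closed traj _; apply/seteqP; split=> [p [p' [q Cq Fq] Fp]|p Cp].
  apply: (traj q Cq); split; first by case: (carries_regular cF Fp) => -[].
  exists 0; left; apply: (pull_path (p' := p') (q' := p')) => //.
  by apply: path_refl; case: (carries_regular cF Fq) => _ [].
have [p' Fp] := carries_total cF (closed_regular (closed _ Cp)).
by exists p' => //; exists p.
Qed.

Lemma image_mono C C' : C `<=` C' -> image F C `<=` image F C'.
Proof. by move=> CC p' [p /CC Cp Fp]; exists p. Qed.

Lemma image_least_period v p p' T : F p p' ->
  least_period v p T -> least_period (A *m v) p' T.
Proof.
move=> Fp [T0 h least]; split=> //; first exact: (carries_path cF h Fp Fp).
by move=> T' T'0 h'; apply: least => //; apply: pull_path h' _ _.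
Qed.

Lemma image_circumference v C c : enorm v != 0 -> circumference v C c ->
  circumference (A *m v) (image F C) (c / enorm v * enorm (A *m v)).
Proof.
move=> nv cC p' [p /cC [T lT ->] Fp].
by exists T; [apply: image_least_period Fp lT | rewrite mulfK].
Qed.

(** The image is built from the two halves of the saddle connection, so that its
    ends, only known to exist, need not be identified. *)
Lemma image_saddle v p p' : v != 0 -> regular p -> F p p' ->
  saddle_trajectory v p -> saddle_trajectory (A *m v) p'.
Proof.
move=> v0 rp Fp [S [[a [b [T [ca cb T0 h ->]]]] tS]].
have [|s [/andP[s0 sT] h1 h2]] := tS p.
  by split; [case: rp | exists 0; left; apply: path_refl; case: rp].
have [a' ca' /path_rev h1'] := carries_cone cF (path_rev h1) ca Fp.
have [b' cb' h2'] := carries_cone cF h2 cb Fp.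
rewrite mulmxN opprK in h1'.
apply: (saddle_through _ _ ca' cb' h1' h2').
  apply: contra v0 => /eqP e.
  by rewrite -(mulKmx (iso_unit isoF) v) e mulmx0.
by case: (carries_regular cF Fp) => _ [].
Qed.

End Iso.

Lemma image_converseK A F v C : affine_iso A F -> parallel_family (A *m v) C ->
  image F (image (converse F) C) = C.
Proof. by move=> i h; apply: (image_converse (affine_isoV i) h). Qed.

Lemma pull_family A F v C : affine_iso A F -> parallel_family (A *m v) C ->
  parallel_family v (image (converse F) C).
Proof.
move=> i /(image_family (affine_isoV i)).
by rewrite mulKmx // (iso_unit i).
Qed.

(** Maximality is pulled back through the inverse automorphism. *)
Lemma image_cylinder A F v C : affine_iso A F ->
  cylinder v C -> cylinder (A *m v) (image F C).
Proof.
move=> i [fam max]; split; first exact: image_family.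
move=> C' fam' sub; rewrite -(image_converseK i fam'); congr image.
apply: max; first exact: pull_family fam'.
rewrite -(image_converse i fam); exact: image_mono.
Qed.

(** The parameter lengths of closed trajectories are preserved, so both
    circumferences are multiplied by the same factor. *)
Lemma image_long_short A F v C1 C2 : affine_iso A F -> enorm v != 0 ->
  long_short_cylinders v C1 C2 ->
  long_short_cylinders (A *m v) (image F C1) (image F C2).
Proof.
move=> i nv [cyl1 cyl2 all [c [circ1 circ2]]]; split; try exact: image_cylinder.
  move=> C cylC; have [fam _] := cylC; rewrite -(image_converseK i fam).
  have := image_cylinder (affine_isoV i) cylC.
  by rewrite mulKmx ?(iso_unit i) // => /all [] ->; [left | right].
exists (c / enorm v * enorm (A *m v)); split; last exact: image_circumference.
by have := image_circumference i nv circ1; rewrite -!mulrA.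
Qed.

(** The conclusion of the theorem for the label K, made independent of how K
    arises from a word. *)
Definition fate (K : 'I_5) v p : Prop :=
  [/\ K \in [:: lbl 1; lbl 2] -> short_trajectory v p,
      K \in [:: lbl 3; lbl 4] -> long_trajectory v p &
      K = lbl 5 -> saddle_trajectory v p].

Lemma enorm_neq0 v : v != 0 -> enorm v != 0.
Proof.
apply: contra => /eqP e; apply/eqP; move/eqP: e.
rewrite sqrtr_eq0 => h; have h0 := sqr_ge0 (v 0 0); have h1 := sqr_ge0 (v 1 0).
have [/eqP e0 /eqP e1] : v 0 0 ^+ 2 = 0 /\ v 1 0 ^+ 2 = 0 by split; lra.
by apply: cV2P; rewrite mxE; apply/eqP; rewrite -sqrf_eq0.
Qed.

Lemma fate_image A F v p p' K : affine_iso A F -> v != 0 -> F p p' ->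
  fate K v p -> fate K (A *m v) p'.
Proof.
move=> i v0 Fp [hs hl hc]; have nv := enorm_neq0 v0; split.
- move=> /hs [C1 [C2 [ls tr]]]; exists (image F C1), (image F C2).
  by split; [apply: image_long_short | apply: image_trajectory Fp tr].
- move=> /hl [C1 [C2 [ls tr]]]; exists (image F C1), (image F C2).
  by split; [apply: image_long_short | apply: image_trajectory Fp tr].
- move=> /hc; apply: (image_saddle i v0 _ Fp).
  by case: (carries_regular (iso_carries i) Fp).
Qed.

End Transport.

(** * The rotation by pi / 5 *)

Section Symmetry.
Variable R : realType.
Local Notation f := (phi R).
Implicit Types (p q r : pt R) (b : bool) (J : 'I_5) (x y s t : R) (v : 'cV[R]_2).

(** The action on direction vectors of a matrix written in the basis of the
    columns of [matP]. *)
Definition conjP (N : 'M[R]_2) : 'M[R]_2 := matP R *m N *m invmx (matP R).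

Lemma conjP_dir (a c a' c' x y : R) :
  conjP (mx2 a c a' c') *m dir x y = dir (a * x + c * y) (a' * x + c' * y).
Proof. by rewrite /conjP /dir -!mulmxA (mulKmx (matP_unit R)) mx2_vec2. Qed.

Lemma conjP_unit N M : M *m N = 1%:M -> N *m M = 1%:M ->
  conjP N \in unitmx /\ invmx (conjP N) = conjP M.
Proof.
move=> h h'; have e : conjP M *m conjP N = 1%:M.
  by rewrite /conjP !mulmxA mulmxKV ?matP_unit // -(mulmxA _ M) h mulmx1 mulmxV ?matP_unit.
have [_ u] := mulmx1_unit e; split=> //.
by rewrite -[LHS]mul1mx -e mulmxK.
Qed.

Definition xc p : R := (invmx (matP R) *m (sg R p.1 *: p.2)) 0 0.
Definition yc p : R := (invmx (matP R) *m (sg R p.1 *: p.2)) 1 0.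

Lemma xc_chart b x y : xc (chart b x y) = x.
Proof. by rewrite /xc /= sgZZ (mulKmx (matP_unit R)) mxE. Qed.

Lemma yc_chart b x y : yc (chart b x y) = y.
Proof. by rewrite /yc /= sgZZ (mulKmx (matP_unit R)) mxE. Qed.

Lemma midpoint_noncorner J : ~ corner (refx R J / 2) (refy R J / 2).
Proof.
have pb := phi_bounds R; move/corner_cases; rewrite !inE !xpair_eqE.
elim/ord5_ind: J; rewrite !refE.
all: do 4?[case/orP]; move=> /andP[/eqP e1 /eqP e2]; lra.
Qed.

Lemma midpoint_inD J : inD (refx R J / 2) (refy R J / 2).
Proof.
have p2 := phi_sq R; have pb := phi_bounds R.
by rewrite inDP; elim/ord5_ind: J; rewrite !refE; split; lra.
Qed.

Lemma midpoint_regular J : regular (side_midpoint R J).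
Proof.
rewrite /side_midpoint midpointE chartF; split; last by move/cone_chart/midpoint_noncorner.
by do 3!eexists; split; [reflexivity | exact: midpoint_inD].
Qed.

(** An affine map g of D onto itself that permutes the sides by perm. As sheets
    move in opposite directions, exchanging them turns a linear part - l of g into
    the derivative l on the surface. *)
Record symmetry (gx gy lx ly : R -> R -> R) (perm : 'I_5 -> 'I_5) : Prop := Symmetry {
  sym_surj : forall K, exists J, K = perm J;
  sym_inj : injective perm;
  sym_stepx : forall x y t e a c,
    gx (x + t * (e * a)) (y + t * (e * c)) = gx x y + t * (- e * lx a c);
  sym_stepy : forall x y t e a c,
    gy (x + t * (e * a)) (y + t * (e * c)) = gy x y + t * (- e * ly a c);
  sym_slack : forall J x y, slack (perm J) (gx x y) (gy x y) = slack J x y;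
  sym_refx : forall J x y,
    gx (refx R J - x) (refy R J - y) = refx R (perm J) - gx x y;
  sym_refy : forall J x y,
    gy (refx R J - x) (refy R J - y) = refy R (perm J) - gy x y }.

Section CellMap.
Variables (gx gy lx ly : R -> R -> R) (perm : 'I_5 -> 'I_5).
Hypothesis symg : symmetry gx gy lx ly perm.
Let perm_surj := sym_surj symg.
Let perm_inj := sym_inj symg.
Let gx_step := sym_stepx symg.
Let gy_step := sym_stepy symg.
Let slack_g := sym_slack symg.
Let gx_ref := sym_refx symg.
Let gy_ref := sym_refy symg.

(** The automorphism of the surface given by a symmetry of D. *)
Definition sheet_swap p : pt R := chart (~~ p.1) (gx (xc p) (yc p)) (gy (xc p) (yc p)).

Lemma sheet_swap_chart b x y : sheet_swap (chart b x y) = chart (~~ b) (gx x y) (gy x y).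
Proof. by rewrite /sheet_swap xc_chart yc_chart. Qed.

Lemma inD_g x y : inD (gx x y) (gy x y) <-> inD x y.
Proof.
split=> h J; first by rewrite -(slack_g J).
by have [K ->] := perm_surj J; rewrite slack_g.
Qed.

Lemma corner_g x y : corner (gx x y) (gy x y) <-> corner x y.
Proof.
split=> -[D [J [K [JK e1 e2]]]]; (split; first by apply/inD_g).
  have [J' EJ] := perm_surj J; have [K' EK] := perm_surj K; subst J K.
  by exists J', K'; split; rewrite -?(slack_g J') -?(slack_g K') //; apply: contra JK => /eqP ->.
exists (perm J), (perm K); rewrite !slack_g; split=> //.
by apply: contra JK => /eqP /perm_inj ->.
Qed.

Lemma sheet_swap_cone p : cone (sheet_swap p) <-> cone p.
Proof.
have [b [x [y ->]]] := chart_surj p.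
by rewrite sheet_swap_chart !cone_chart; exact: corner_g.
Qed.

Lemma sheet_swap_glued p q : glued p q -> glued (sheet_swap p) (sheet_swap q).
Proof.
have [b [x [y ->]]] := chart_surj p => /glued_chart [J [D e ->]].
rewrite !sheet_swap_chart; apply/glued_chart; exists (perm J).
by rewrite slack_g gx_ref gy_ref; split=> //; apply/inD_g.
Qed.

Lemma sheet_swap_same p q : same p q -> same (sheet_swap p) (sheet_swap q).
Proof.
case=> [->|[n g]]; first exact: same_refl.
by right; split; [move/sheet_swap_cone | apply: sheet_swap_glued].
Qed.

Lemma sheet_swap_valid p : valid p -> valid (sheet_swap p).
Proof.
move=> [b [x [y [-> D]]]]; rewrite sheet_swap_chart; do 3!eexists; split; first by [].
exact/inD_g.
Qed.

Lemma sheet_swap_path wx wy p t q : straight_path (dir wx wy) p t q ->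
  straight_path (dir (lx wx wy) (ly wx wy)) (sheet_swap p) t (sheet_swap q).
Proof.
elim/path_chart_ind=> {p t q}; last first.
  move=> p q q' r s t _ h1 n g _ h2; apply: path_cross h1 _ (sheet_swap_glued g) h2.
  by move/sheet_swap_cone.
move=> b x y t t0 D0 D1; rewrite !sheet_swap_chart gx_step gy_step -sgN.
apply: chord => //; first exact/inD_g.
by rewrite sgN -gx_step -gy_step; apply/inD_g.
Qed.

Lemma sheet_swap_midpoint J : same (sheet_swap (side_midpoint R J)) (side_midpoint R (perm J)).
Proof.
have half (a c : R) : c - a = a -> a = c / 2 by lra.
have [V n] := midpoint_regular J; move: V n; rewrite /side_midpoint !midpointE !chartF => V n.
have Vg := sheet_swap_valid V; have ng : ~ cone (sheet_swap (chart false (refx R J / 2) (refy R J / 2))).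
  by move/sheet_swap_cone.
move: Vg ng; rewrite sheet_swap_chart.
have hx : refx R J - refx R J / 2 = refx R J / 2 by lra.
have hy : refy R J - refy R J / 2 = refy R J / 2 by lra.
rewrite (half (gx _ _) (refx R (perm J))); last by rewrite -gx_ref hx hy.
rewrite (half (gy _ _) (refy R (perm J))); last by rewrite -gy_ref hx hy.
move=> [b [x [y [/chart_inj [_ <- <-] D]]]] n'; right; split=> //.
apply/glued_chart; exists (perm J); split=> //; last by congr chart; lra.
have := slack_ref (perm J) (refx R (perm J) / 2) (refy R (perm J) / 2).
have -> : refx R (perm J) - refx R (perm J) / 2 = refx R (perm J) / 2 by lra.
have -> : refy R (perm J) - refy R (perm J) / 2 = refy R (perm J) / 2 by lra.
lra.
Qed.

End CellMap.

Definition rot_mx : 'M[R]_2 := mx2 0 (-1) 1 f.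

(** Exchanging the sheets adds a half turn to the rotation by pi / 5, so D itself
    turns by 6 pi / 5, three steps along its sides. *)
Definition rot_side (J : 'I_5) : 'I_5 :=
  match val J with
  | 0%N => lbl 4 | 1%N => lbl 5 | 2%N => lbl 2 | 3%N => lbl 3 | _ => lbl 1
  end.

Definition unrot_side (J : 'I_5) : 'I_5 :=
  match val J with
  | 0%N => lbl 5 | 1%N => lbl 3 | 2%N => lbl 4 | 3%N => lbl 1 | _ => lbl 2
  end.

Lemma rot_sideE : (rot_side (lbl 1) = lbl 4) * (rot_side (lbl 2) = lbl 5) *
  (rot_side (lbl 3) = lbl 2) * (rot_side (lbl 4) = lbl 3) * (rot_side (lbl 5) = lbl 1).
Proof. by rewrite /rot_side /lbl !valK5. Qed.

Lemma unrot_sideE : (unrot_side (lbl 1) = lbl 5) * (unrot_side (lbl 2) = lbl 3) *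
  (unrot_side (lbl 3) = lbl 4) * (unrot_side (lbl 4) = lbl 1) *
  (unrot_side (lbl 5) = lbl 2).
Proof. by rewrite /unrot_side /lbl !valK5. Qed.

Lemma rot_sideK : cancel rot_side unrot_side.
Proof. by elim/ord5_ind; rewrite !rot_sideE !unrot_sideE. Qed.

Lemma unrot_sideK : cancel unrot_side rot_side.
Proof. by elim/ord5_ind; rewrite !unrot_sideE !rot_sideE. Qed.

Definition rotx (x y : R) : R := y.
Definition roty (x y : R) : R := 2 * f + 1 - x - f * y.
Definition unrotx (x y : R) : R := 2 * f + 1 - y - f * x.
Definition unroty (x y : R) : R := x.

Lemma rot_slack J x y : slack (rot_side J) (rotx x y) (roty x y) = slack J x y.
Proof.
have p2 := phi_sq R; rewrite /rotx /roty.
have fy : f * (f * y) = f * y + y by rewrite mulrA p2; lra.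
by elim/ord5_ind: J; rewrite !rot_sideE !slackE; lra.
Qed.

Lemma unrot_slack J x y : slack (unrot_side J) (unrotx x y) (unroty x y) = slack J x y.
Proof.
have p2 := phi_sq R; rewrite /unrotx /unroty.
have fx : f * (f * x) = f * x + x by rewrite mulrA p2; lra.
by elim/ord5_ind: J; rewrite !unrot_sideE !slackE; lra.
Qed.

Lemma rot_symmetry :
  symmetry rotx roty (fun a c => - c) (fun a c => a + f * c) rot_side.
Proof.
have p2 := phi_sq R; split.
- by move=> K; exists (unrot_side K); rewrite unrot_sideK.
- exact: can_inj rot_sideK.
- by move=> *; rewrite /rotx; lra.
- by move=> *; rewrite /roty; lra.
- exact: rot_slack.
- by elim/ord5_ind=> x y; rewrite rot_sideE !refE /rotx; lra.
- by elim/ord5_ind=> x y; rewrite rot_sideE !refE /roty; lra.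
Qed.

Lemma unrot_symmetry :
  symmetry unrotx unroty (fun a c => f * a + c) (fun a c => - a) unrot_side.
Proof.
have p2 := phi_sq R; split.
- by move=> K; exists (rot_side K); rewrite rot_sideK.
- exact: can_inj unrot_sideK.
- by move=> *; rewrite /unrotx; lra.
- by move=> *; rewrite /unroty; lra.
- exact: unrot_slack.
- by elim/ord5_ind=> x y; rewrite unrot_sideE !refE /unrotx; lra.
- by elim/ord5_ind=> x y; rewrite unrot_sideE !refE /unroty; lra.
Qed.

Definition rot_rel p p' := regular p /\ same (sheet_swap rotx roty p) p'.

Lemma same_valid p q : valid p -> same p q -> valid q.
Proof. by move=> V /(path_same 0 V) /path_valid []. Qed.

Lemma same_regular p q : regular p -> same p q -> regular q.
Proof.
move=> [V n] s; split; first exact: same_valid V s.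
by move=> /(same_cone (same_sym s)).
Qed.

Lemma rot_rel_converse p p' : rot_rel p p' -> regular p' /\ same (sheet_swap unrotx unroty p') p.
Proof.
case=> r s; split.
  apply: same_regular s; case: r => V n; split; first exact: sheet_swap_valid rot_symmetry _ V.
  by move/(sheet_swap_cone rot_symmetry).
have := sheet_swap_same unrot_symmetry (same_sym s).
rewrite (_ : sheet_swap unrotx unroty (sheet_swap rotx roty p) = p) //.
have [b [x [y ->]]] := chart_surj p; rewrite !sheet_swap_chart negbK.
by congr chart; rewrite /unrotx /unroty /rotx /roty; lra.
Qed.

Lemma rot_iso : affine_iso (conjP rot_mx) rot_rel.
Proof.
have p2 := phi_sq R.
pose unrot_mx : 'M[R]_2 := mx2 f 1 (-1) 0.
have [u e] : conjP rot_mx \in unitmx /\ invmx (conjP rot_mx) = conjP unrot_mx.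
  by apply: conjP_unit; rewrite mx2_mul -mx2_1; congr mx2; lra.
have reg p p' : rot_rel p p' -> regular p /\ regular p'.
  by move=> /[dup] -[? _] /rot_rel_converse [].
split=> //.
  split=> //.
  - move=> p r; exists (sheet_swap rotx roty p); split=> //; exact: same_refl.
  - move=> v p t q p' q' h [_ Fp] [_ Fq]; have [a [c E]] := dir_surj v.
    rewrite {}E conjP_dir in h *.
    apply: path_same_r Fq; apply: path_same_l (same_sym Fp) _.
    have := sheet_swap_path rot_symmetry h; congr straight_path; congr dir; lra.
  - move=> v p t q p' h cq [_ Fp]; exists (sheet_swap rotx roty q).
      exact/(sheet_swap_cone rot_symmetry).
    have [a [c E]] := dir_surj v; rewrite {}E conjP_dir in h *.
    apply: path_same_l (same_sym Fp) _.
    have := sheet_swap_path rot_symmetry h; congr straight_path; congr dir; lra.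
rewrite e; split.
- by move=> p p' /reg [].
- move=> p r; exists (sheet_swap unrotx unroty p); split.
    case: r => V n; split; first exact: sheet_swap_valid unrot_symmetry _ V.
    by move/(sheet_swap_cone unrot_symmetry).
  rewrite (_ : sheet_swap rotx roty (sheet_swap unrotx unroty p) = p); first exact: same_refl.
  have [b [x [y ->]]] := chart_surj p; rewrite !sheet_swap_chart negbK.
  by congr chart; rewrite /unrotx /unroty /rotx /roty; lra.
- move=> v p t q p' q' h /rot_rel_converse [_ Fp] /rot_rel_converse [_ Fq].
  have [a [c E]] := dir_surj v; rewrite {}E conjP_dir in h *.
  apply: path_same_r Fq; apply: path_same_l (same_sym Fp) _.
  have := sheet_swap_path unrot_symmetry h; congr straight_path; congr dir; lra.
- move=> v p t q p' h cq /rot_rel_converse [_ Fp]; exists (sheet_swap unrotx unroty q).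
    exact/(sheet_swap_cone unrot_symmetry).
  have [a [c E]] := dir_surj v; rewrite {}E conjP_dir in h *.
  apply: path_same_l (same_sym Fp) _.
  have := sheet_swap_path unrot_symmetry h; congr straight_path; congr dir; lra.
Qed.

Lemma rot_rel_midpoint J : rot_rel (side_midpoint R J) (side_midpoint R (rot_side J)).
Proof.
split; first exact: midpoint_regular.
exact: sheet_swap_midpoint rot_symmetry J.
Qed.

End Symmetry.

(** * The horizontal cylinders as strips *)

Section Strips.
Variable R : realType.
Local Notation f := (phi R).
Implicit Types (p q r : pt R) (b s : bool) (J : 'I_5) (x y t : R) (v : 'cV[R]_2).

(** The cylinder s is short for s = true and long for s = false. In D it occupies
    the heights between [bot] and [top], bounded by a left and a right side of D;
    [circ] is its circumference and [cen] is twice the abscissa of the midpoint of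
    the right side. *)
Definition bot s : R := if s then f else 0.
Definition top s : R := if s then f + 1 else f.
Definition circ s : R := if s then f else f + 1.
Definition cen s : R := if s then f else 2 * f + 1.
Definition lslope s : R := if s then 0 else -1.
Definition rslope s : R := if s then - f else 1 - f.
Definition left_x s y : R := (if s then 0 else f) + lslope s * y.
Definition right_x s y : R := (if s then 2 * f + 1 else f + 1) + rslope s * y.
(** The height on the other sheet of a point of the strip: the second sheet is
    read upside down. *)
Definition mirror s y : R := bot s + top s - y.
Definition right_side s : 'I_5 := if s then lbl 2 else lbl 4.
Definition left_side s : 'I_5 := if s then lbl 1 else lbl 3.

Definition band s y : Prop := bot s <= y <= top s.
Definition inner s y : Prop := bot s < y < top s.

Lemma inner_band s y : inner s y -> band s y.
Proof. by rewrite /inner /band; lra. Qed.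

Lemma band_mirror s y : band s y -> band s (mirror s y).
Proof. by rewrite /band /mirror; lra. Qed.

Lemma inner_mirror s y : inner s y -> inner s (mirror s y).
Proof. by rewrite /inner /mirror; lra. Qed.

Lemma mirrorK s : involutive (mirror s).
Proof. by move=> y; rewrite /mirror; lra. Qed.

Lemma left_xD s y d : left_x s (y + d) = left_x s y + lslope s * d.
Proof. by rewrite /left_x; ring. Qed.

Lemma right_xD s y d : right_x s (y + d) = right_x s y + rslope s * d.
Proof. by rewrite /right_x; ring. Qed.

Lemma left_x_mirror s y : left_x s (mirror s y) = cen s - circ s - left_x s y.
Proof. by rewrite /left_x /mirror /lslope /cen /circ /bot /top; case: s; lra. Qed.

Lemma right_x_mirror s y : right_x s (mirror s y) = cen s - right_x s y.
Proof.
have p2 := phi_sq R.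
by rewrite /right_x /mirror /rslope /cen /bot /top; case: s; lra.
Qed.

Lemma circ_gt0 s : 0 < circ s.
Proof. by have := phi_bounds R; rewrite /circ; case: s; lra. Qed.

Lemma strip_inD s x y : band s y -> inD x y <-> left_x s y <= x <= right_x s y.
Proof.
have p2 := phi_sq R; have pb := phi_bounds R; have p0 := phi_gt0 R.
have kk (k : R) : 0 <= k <-> 0 <= f * k by rewrite pmulr_rge0.
rewrite inDP /band /left_x /right_x /lslope /rslope /bot /top.
case: s => /= yb; split=> [[h1 h2 h3 h4 h5]|xb].
- lra.
- have := (kk (y - f)).1 ltac:(lra); have := (kk (f + 1 - y)).1 ltac:(lra).
  have := (kk x).1 ltac:(lra).
  have := (kk (2 * f + 1 - f * y - x)).1 ltac:(lra).
  have fy : f * (f * y) = f * y + y by rewrite mulrA p2; lra.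
  by move=> ? ? ? ?; split; lra.
- have := (kk (x + y - f)).2 ltac:(lra).
  have := (kk (f + 1 + (1 - f) * y - x)).2.
  have fy : f * (f * y) = f * y + y by rewrite mulrA p2; lra.
  by move=> /(_ ltac:(lra)) ? ?; lra.
- have := (kk (f - y)).1 ltac:(lra); have := (kk y).1 ltac:(lra).
  have := (kk (x + y - f)).1 ltac:(lra).
  have := (kk (f + 1 + (1 - f) * y - x)).1 ltac:(lra).
  have fy : f * (f * y) = f * y + y by rewrite mulrA p2; lra.
  by move=> ? ? ? ?; split; lra.
Qed.

Lemma left_le_right s y : band s y -> left_x s y <= right_x s y.
Proof.
have p2 := phi_sq R; have pb := phi_bounds R; have p0 := phi_gt0 R.
rewrite /band /left_x /right_x /lslope /rslope /bot /top; case: s => /= yb.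
  have : 0 <= f * (f + 1 - y) by rewrite mulr_ge0 ?(ltW p0) //; lra.
  lra.
have : 0 <= f * (f - y) by rewrite mulr_ge0 ?(ltW p0) //; lra.
have : 0 <= y * (2 - f) by rewrite mulr_ge0 //; lra.
lra.
Qed.

Lemma left_lt_right s y : inner s y -> left_x s y < right_x s y.
Proof.
have p2 := phi_sq R; have pb := phi_bounds R; have p0 := phi_gt0 R.
rewrite /inner /left_x /right_x /lslope /rslope /bot /top; case: s => /= yb.
  have : 0 < f * (f + 1 - y) by rewrite mulr_gt0 //; lra.
  lra.
have : 0 < y * (2 - f) by rewrite mulr_gt0 //; lra.
lra.
Qed.

(** The pieces of D and of -D at the same level of the cylinder fill its
    circumference. *)
Lemma width_mirror s y :
  (right_x s y - left_x s y) + (right_x s (mirror s y) - left_x s (mirror s y)) = circ s.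
Proof. by rewrite left_x_mirror right_x_mirror; lra. Qed.

Lemma right_le_left_circ s y : band s y -> right_x s y <= left_x s y + circ s.
Proof.
by move=> /band_mirror /left_le_right; rewrite left_x_mirror right_x_mirror; lra.
Qed.

Lemma ref_right_side s : (refx R (right_side s) = cen s) * (refy R (right_side s) = bot s + top s).
Proof. by rewrite /right_side /cen /bot /top; case: s; rewrite !refE; split=> //; lra. Qed.

Lemma ref_left_side s :
  (refx R (left_side s) = cen s - circ s) * (refy R (left_side s) = bot s + top s).
Proof. by rewrite /left_side /cen /bot /top /circ; case: s; rewrite !refE; split=> //; lra. Qed.

Lemma slack_right_side s x y : slack (right_side s) x y = 0 <-> x = right_x s y.
Proof.
have p2 := phi_sq R; rewrite /right_side /right_x /rslope; case: s; rewrite slackE; split=> h; try lra.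
  have : f * (2 * f + 1 - f * x - y) = 0 by rewrite h mulr0.
  have : f * (f * x) = f * x + x by rewrite mulrA p2; lra.
  lra.
have : f * (f * y) = f * y + y by rewrite mulrA p2; lra.
by rewrite h; lra.
Qed.

Lemma slack_left_side s x y : slack (left_side s) x y = 0 <-> x = left_x s y.
Proof.
have p2 := phi_sq R; rewrite /left_side /left_x /lslope; case: s; rewrite slackE; split=> h; try lra.
  have : f * (f * x + f * y - f - 1) = 0 by rewrite h mulr0.
  have : f * (f * x) = f * x + x by rewrite mulrA p2; lra.
  have : f * (f * y) = f * y + y by rewrite mulrA p2; lra.
  lra.
by rewrite h; lra.
Qed.

(** Inside the cylinder the only gluings are those along its two slanted sides. *)
Lemma inner_side s J x y : inner s y -> inD x y -> slack J x y = 0 ->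
  J = right_side s \/ J = left_side s.
Proof.
have p2 := phi_sq R; have pb := phi_bounds R; have p0 := phi_gt0 R.
move=> i D e; have b := inner_band i; move: D => /(strip_inD _ b); move: i e.
rewrite /inner /right_side /left_side /left_x /right_x /lslope /rslope /bot /top.
have fx : f * (f * x) = f * x + x by rewrite mulrA p2; lra.
have fy : f * (f * y) = f * y + y by rewrite mulrA p2; lra.
case: s {b} => /= i + d.
  have h1 : 0 < f * (y - f) by rewrite mulr_gt0 //; lra.
  have h2 : 0 <= f * (2 * f + 1 - f * y - x) by rewrite mulr_ge0 ?(ltW p0) //; lra.
  have h3 : 0 <= f * x by rewrite mulr_ge0 ?(ltW p0) //; lra.
  by elim/ord5_ind: J; rewrite slackE => e; auto; exfalso; lra.
by elim/ord5_ind: J; rewrite slackE => e; auto; exfalso; lra.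
Qed.

Lemma inner_noncorner s x y : inner s y -> ~ corner x y.
Proof.
have pb := phi_bounds R; rewrite /inner /bot /top => i /corner_cases.
rewrite !inE !xpair_eqE; move: i; case: s => i.
all: by do 4?[case/orP]; move=> /andP[/eqP e1 /eqP e2]; lra.
Qed.

Lemma edge_corner s x y : band s y -> ~ inner s y -> inD x y ->
  x = left_x s y \/ x = right_x s y -> corner x y.
Proof.
have p2 := phi_sq R; move=> b ni D e; apply/corner_cases.
have pb := phi_bounds R.
have ey : y = bot s \/ y = top s.
  move: b ni; rewrite /band /inner => /andP[b1 b2] ni.
  have [h|h] := eqVneq y (bot s); first by left.
  have [h'|h'] := eqVneq y (top s); first by right.
  by case: ni; rewrite !lt_neqAle b1 b2 h' eq_sym h.
suff : (x = f /\ y = 0) \/ (x = f + 1 /\ y = 0) \/ (x = f /\ y = f) \/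
       (x = 0 /\ y = f + 1) \/ (x = 0 /\ y = f).
  by rewrite !inE !xpair_eqE; case=> [|[|[|[|]]]] [-> ->]; rewrite !eqxx ?orbT.
move: e ey; rewrite /left_x /right_x /lslope /rslope /bot /top.
case: s {b ni} => /= -[] ex [] ey; rewrite ey in ex *.
- by do 4 right; split; lra.
- by do 3 right; left; split; lra.
- by do 2 right; left; split; lra.
- by do 3 right; left; split; lra.
- by left; split; lra.
- by do 4 right; split; lra.
- by right; left; split; lra.
- by do 2 right; left; split; lra.
Qed.

End Strips.

(** * Developing a cylinder into its strip *)

Section Development.
Variable R : realType.
Local Notation f := (phi R).
Implicit Types (p q r : pt R) (b s : bool) (J : 'I_5) (x y t : R) (v : 'cV[R]_2).
Implicit Types (n k : int).

(** The strip is tiled alternately by translates of the piece of D, for b = false,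
    and of its point reflection, for b = true; these are the coordinates in D of
    the point (x, y) of the strip, read in the tile (b, n). *)
Definition tilex s b n (x : R) : R :=
  if b then cen R s + n%:~R * circ R s - x else x - n%:~R * circ R s.

Definition tiley s b (y : R) : R := if b then mirror s y else y.

(** The covering of the closed cylinder s by its strip, as a relation: (x, y) lies
    over p. *)
Definition develops s x y p : Prop := band s y /\
  exists b n, p = chart b (tilex s b n x) (tiley s b y) /\
              inD (tilex s b n x) (tiley s b y).

Lemma band_tiley s b y : band s y -> band s (tiley s b y).
Proof. by case: b => //; apply: band_mirror. Qed.

Lemma inner_tiley s b y : inner s y -> inner s (tiley s b y).
Proof. by case: b => //; apply: inner_mirror. Qed.

Lemma tile_false s n x y : band s y -> inD (tilex s false n x) (tiley s false y) <->
  left_x s y <= x - n%:~R * circ R s <= right_x s y.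
Proof. exact: strip_inD. Qed.

Lemma tile_true s n x y : band s y -> inD (tilex s true n x) (tiley s true y) <->
  right_x s y <= x - n%:~R * circ R s <= left_x s y + circ R s.
Proof.
move=> h; rewrite /= (strip_inD _ (band_mirror h)) left_x_mirror right_x_mirror.
by split=> ?; lra.
Qed.

Lemma develops_valid s x y p : develops s x y p -> valid p.
Proof. by move=> [_ [b [n [-> D]]]]; do 3!eexists; split; first by []. Qed.

Lemma develops_noncone s x y p : inner s y -> develops s x y p -> ~ cone p.
Proof.
move=> i [_ [b [n [-> D]]]] /cone_chart; apply: (@inner_noncorner _ s).
exact: inner_tiley.
Qed.

Lemma develops_total s x y : band s y -> exists p, develops s x y p.
Proof.
move=> h; have c0 := circ_gt0 R s.
pose n := Num.floor ((x - left_x s y) / circ R s).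
have n1 : n%:~R * circ R s <= x - left_x s y.
  by rewrite -ler_pdivlMr // Num.Theory.floor_le.
have n2 : x - left_x s y < (n%:~R + 1) * circ R s.
  rewrite -ltr_pdivrMr //; have := Num.Theory.floorD1_gt ((x - left_x s y) / circ R s).
  by rewrite intrD.
have [le|gt] := lerP (x - n%:~R * circ R s) (right_x s y).
  exists (chart false (tilex s false n x) (tiley s false y)); split=> //.
  by exists false, n; split=> //; apply/tile_false => //; lra.
exists (chart true (tilex s true n x) (tiley s true y)); split=> //.
by exists true, n; split=> //; apply/tile_true => //; lra.
Qed.

Lemma tilexD s b n k x : tilex s b (n + k) (x + k%:~R * circ R s) = tilex s b n x.
Proof. by rewrite /tilex; case: b; rewrite intrD; lra. Qed.

Lemma develops_shift s x y p k : develops s x y p -> develops s (x + k%:~R * circ R s) y p.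
Proof.
by move=> [h [b [n [e D]]]]; split=> //; exists b, (n + k); rewrite tilexD.
Qed.

(** Points over the same p differ by a deck translation. *)
Lemma develops_fiber s x y x' y' p : develops s x y p -> develops s x' y' p ->
  y = y' /\ exists k, x' = x + k%:~R * circ R s.
Proof.
move=> [_ [b [n [-> _]]]] [_ [b' [m [/chart_inj [<- ex ey] _]]]].
move: ex ey; case: b; rewrite /tilex /tiley /mirror => ex ey; split; try lra.
  by exists (m - n); rewrite intrB; lra.
by exists (m - n); rewrite intrB; lra.
Qed.

Lemma develops_same s x y p q : inner s y -> develops s x y p -> same p q -> develops s x y q.
Proof.
move=> i d [<-//|[_]]; case: d => h [b [n [-> D]]] /glued_chart [J [_ e ->]].
split=> //; have D' := inD_ref D e.
have [EJ|EJ] := inner_side (inner_tiley b i) D e; rewrite EJ in D' *.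
  exists (~~ b), n; rewrite !ref_right_side in D' *.
  have -> : tilex s (~~ b) n x = cen R s - tilex s b n x.
    by case: b {D e D'} => /=; lra.
  have -> : tiley s (~~ b) y = bot R s + top R s - tiley s b y.
    by case: b {D e D'} => /=; rewrite /mirror; lra.
  by [].
exists (~~ b), (if b then n + 1 else n - 1); rewrite !ref_left_side in D' *.
have -> : tilex s (~~ b) (if b then n + 1 else n - 1) x = cen R s - circ R s - tilex s b n x.
  by case: b {D e D'} => /=; rewrite ?intrB ?intrD; lra.
have -> : tiley s (~~ b) y = bot R s + top R s - tiley s b y.
  by case: b {D e D'} => /=; rewrite /mirror; lra.
by [].
Qed.

(** The piece of D is at most one circumference wide, and it attains that width
    only on the boundary of the strip, between two vertices. *)
Lemma corner_shift s x x' y n n' : band s y -> inD x y -> inD x' y ->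
  x' = x + (n - n')%:~R * circ R s -> x = x' \/ corner x y /\ corner x' y.
Proof.
move=> h D D' e; have c0 := circ_gt0 R s.
have w := width_mirror s y; have w0 := left_le_right (band_mirror h).
have /(strip_inD _ h) xb := D; have /(strip_inD _ h) xb' := D'.
have [lt|gt|nn] := ltgtP n n'; last first.
- by left; rewrite e nn subrr mul0r addr0.
- right; have n1 : 1 <= (n - n')%:~R :> R by rewrite -[1]/(1%:~R) ler_int -gtz0_ge1 subr_gt0.
  have n2 : circ R s <= (n - n')%:~R * circ R s by rewrite ler_pMl.
  have ni : ~ inner s y by move=> /inner_mirror /left_lt_right; lra.
  by split; apply: (edge_corner h ni) => //; [left | right]; lra.
- right; have n1 : 1 <= (n' - n)%:~R :> R by rewrite -[1]/(1%:~R) ler_int -gtz0_ge1 subr_gt0.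
  have n2 : circ R s <= (n' - n)%:~R * circ R s by rewrite ler_pMl.
  have ee : (n' - n)%:~R = - (n - n')%:~R :> R by rewrite -mulrNz opprB.
  have ni : ~ inner s y by move=> /inner_mirror /left_lt_right; lra.
  by split; apply: (edge_corner h ni) => //; [right | left]; lra.
Qed.

(** Tiles meet only along the slanted sides, where the two readings are glued, and
    at vertices. *)
Lemma develops_uniq s x y p q : develops s x y p -> develops s x y q ->
  same p q \/ (cone p /\ cone q).
Proof.
move=> [h [b [n [-> D]]]] [_ [b' [m [-> D']]]]; have c0 := circ_gt0 R s.
wlog : b b' n m D D' / b -> b'.
  move=> W; case: b b' D D' => -[] D D'; try by apply: W.
  by case: (W false true m n D' D) => // [/same_sym|[]]; auto.
move: D'; case: (eqVneq b b') => [<- D' _|].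
  suff : tilex s b n x = tilex s b m x \/ corner (tilex s b n x) (tiley s b y)
      /\ corner (tilex s b m x) (tiley s b y).
    by case=> [->|[c c']]; [left; left | right; split; apply/cone_chart].
  apply: (@corner_shift s _ _ _ (if b then m else n) (if b then n else m) (band_tiley b h) D D').
  by rewrite /tilex; case: b {D D'}; rewrite intrB; lra.
case: b b' D => -[] // D _ D' imp; first by have := imp isT.
clear p q; set p := chart false _ _; set q := chart true _ _.
suff g : glued p q.
  have [c|c] := pselect (cone p); last by left; right.
  by right; split=> //; apply: (glued_cone g).
have /(tile_false n _ h) xn := D; have /(tile_true m _ h) xm := D'.
have k1 : n%:~R - m%:~R <= 1 :> R.
  have : (n%:~R - m%:~R) * circ R s <= 1 * circ R s by lra.
  by rewrite ler_pM2r.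
have k0 : 0 <= n%:~R - m%:~R :> R.
  have : 0 * circ R s <= (n%:~R - m%:~R) * circ R s by lra.
  by rewrite ler_pM2r.
have mn : n = m \/ n = m + 1.
  move: k0 k1; rewrite -intrB -[1]/(1%:~R) ler_int ler0z => k0 k1.
  have [->|nm] := eqVneq n m; [by left | right].
  have : 1 <= n - m by rewrite -gtz0_ge1 lt_neqAle k0 andbT eq_sym subr_eq0.
  by move=> k2; apply/eqP; rewrite addrC -subr_eq eq_le k1 k2.
apply/glued_chart; case: mn => e; [exists (right_side s) | exists (left_side s)].
  rewrite !ref_right_side; split=> //; last by rewrite /q e /=; congr chart; rewrite /mirror; lra.
  by apply/slack_right_side; rewrite /=; rewrite e in xn *; lra.
rewrite !ref_left_side; split=> //.
  by apply/slack_left_side; rewrite /=; rewrite e intrD in xn *; lra.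
by rewrite /q e /= intrD; congr chart; rewrite /mirror; lra.
Qed.

End Development.

(** * Straight paths in a cylinder are segments of its strip *)

Section StripPaths.
Variable R : realType.
Local Notation f := (phi R).
Implicit Types (p q r : pt R) (b s : bool) (J : 'I_5) (x y t : R) (v : 'cV[R]_2).
Implicit Types (n k : int).

(** The hyperelliptic involution. It reverses directions and exchanges the two
    kinds of tiles, which reduces paths to the left to paths to the right. *)
Definition flip : pt R -> pt R := sheet_swap (fun x _ => x) (fun _ y => y).

Lemma flip_symmetry : symmetry (fun x _ : R => x) (fun _ y : R => y)
  (fun a _ => - a) (fun _ c => - c) id.
Proof.
split=> //.
- by move=> K; exists K.
- by move=> *; lra.
- by move=> *; lra.
Qed.

Lemma flip_chart b x y : flip (chart b x y) = chart (~~ b) x y.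
Proof. exact: sheet_swap_chart. Qed.

Lemma flip_path wx wy p t q : straight_path (dir wx wy) p t q ->
  straight_path (dir (- wx) (- wy)) (flip p) t (flip q).
Proof. exact: (sheet_swap_path flip_symmetry). Qed.

Lemma tile_flip s b n x y :
  tilex s (~~ b) (- n) (cen R s - x) = tilex s b n x /\
  tiley s (~~ b) (mirror s y) = tiley s b y.
Proof. by case: b => /=; rewrite ?mirrorK mulrNz; split=> //; lra. Qed.

Lemma develops_flip s x y p : develops s x y p -> develops s (cen R s - x) (mirror s y) (flip p).
Proof.
move=> [h [b [n [-> D]]]]; split; first exact: band_mirror.
have [ex ey] := tile_flip s b n x y.
by exists (~~ b), (- n); rewrite ex ey flip_chart.
Qed.

Lemma first_zero (a m T : R) : 0 <= T -> 0 <= a -> a + T * m < 0 ->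
  exists t, [/\ 0 <= t, t < T & a + t * m = 0].
Proof.
move=> T0 a0 lt; have m0 : m < 0.
  rewrite ltNge; apply/negP => m0; have := mulr_ge0 T0 m0; lra.
exists (a / - m); split.
- by rewrite divr_ge0 // oppr_ge0 ltW.
- by rewrite ltr_pdivrMr ?oppr_gt0 // mulrN; lra.
- by rewrite invrN mulrN mulNr divfK ?subrr // lt_eqF.
Qed.

Lemma tile_chord s b n wx wy x y t : 0 <= t ->
  inD (tilex s b n x) (tiley s b y) ->
  inD (tilex s b n (x + t * wx)) (tiley s b (y + t * wy)) ->
  straight_path (dir wx wy) (chart b (tilex s b n x) (tiley s b y)) t
    (chart b (tilex s b n (x + t * wx)) (tiley s b (y + t * wy))).
Proof.
have -> : tilex s b n (x + t * wx) = tilex s b n x + t * (sg R b * wx).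
  by rewrite /tilex /sg; case: b; rewrite ?expr0 ?expr1; lra.
have -> : tiley s b (y + t * wy) = tiley s b y + t * (sg R b * wy).
  by rewrite /tiley /sg /mirror; case: b; rewrite ?expr0 ?expr1; lra.
exact: chord.
Qed.

Lemma inner_move s y wy t T : inner s y -> band s (y + T * wy) -> 0 <= t -> t < T ->
  inner s (y + t * wy).
Proof.
rewrite /inner /band => /andP[i1 i2] /andP[b1 b2] t0 tT.
have T0 : 0 < T by lra.
have [w|w] := lerP 0 wy.
  have h1 : 0 <= t * wy by rewrite mulr_ge0.
  have [w0|w0] := eqVneq wy 0; first by rewrite w0 mulr0; lra.
  have h2 : t * wy < T * wy by rewrite ltr_pM2r // lt_neqAle eq_sym w0.
  by apply/andP; split; lra.
have h1 : t * wy <= 0 by rewrite mulr_ge0_le0 // ltW.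
have h2 : T * wy < t * wy by rewrite ltr_nM2r.
by apply/andP; split; lra.
Qed.

Section Right.
Variables (s : bool) (wx wy : R).

(** Some end point of the path is asserted rather than any given one: over a
    vertex, only the sector of the tile in which the segment arrives is reached. *)
Definition reaches x y p T : Prop :=
  exists2 q, develops s (x + T * wx) (y + T * wy) q & straight_path (dir wx wy) p T q.

(** Paths to the right, by the number N of pairs of tiles that separate the start
    from the end: a segment crosses into the next tile on its right until it has
    reached the tile of its end. *)
Definition right_false (N : nat) : Prop := forall n x y T,
  inner s y -> 0 <= T -> band s (y + T * wy) ->
  inD (tilex s false n x) (tiley s false y) ->
  left_x s (y + T * wy) <= x + T * wx - n%:~R * circ R s
    <= left_x s (y + T * wy) + N%:R * circ R s ->
  reaches x y (chart false (tilex s false n x) (tiley s false y)) T.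

(** The same for a start in a tile of the second kind. *)
Definition right_true (N : nat) : Prop := forall n x y T,
  inner s y -> 0 <= T -> band s (y + T * wy) ->
  inD (tilex s true n x) (tiley s true y) ->
  right_x s (y + T * wy) <= x + T * wx - n%:~R * circ R s
    <= left_x s (y + T * wy) + N.+1%:R * circ R s ->
  reaches x y (chart true (tilex s true n x) (tiley s true y)) T.

Lemma tile_reaches b n x y T : 0 <= T -> band s (y + T * wy) ->
  inD (tilex s b n x) (tiley s b y) ->
  inD (tilex s b n (x + T * wx)) (tiley s b (y + T * wy)) ->
  reaches x y (chart b (tilex s b n x) (tiley s b y)) T.
Proof.
move=> T0 h D D'; exists (chart b (tilex s b n (x + T * wx)) (tiley s b (y + T * wy))).
  by split=> //; exists b, n.
exact: tile_chord.
Qed.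

Lemma reaches_trans x y p t q T : 0 <= t ->
  straight_path (dir wx wy) p t q -> reaches (x + t * wx) (y + t * wy) q (T - t) ->
  reaches x y p T.
Proof.
have eT (z w : R) : z + t * w + (T - t) * w = z + T * w by lra.
move=> t0 h [r]; rewrite !eT => d h'; exists r => //.
have -> : T = t + (T - t) by lra.
exact: path_cat h h'.
Qed.

Lemma right_true_of_false N : right_false N -> right_true N.
Proof.
move=> IH n x y T i T0 h D /andP[r1 r2]; have bd := inner_band i.
have [le|gt] := lerP (x + T * wx - n%:~R * circ R s) (left_x s (y + T * wy) + circ R s).
  by apply: tile_reaches => //; apply/tile_true => //; rewrite r1.
have /(tile_true n _ bd) D0 := D.
have [t [t0 tT te]] : exists t, [/\ 0 <= t, t < T &
    left_x s y + circ R s - (x - n%:~R * circ R s) + t * (lslope R s * wy - wx) = 0].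
  by apply: first_zero => //; [lra | move: gt; rewrite left_xD; lra].
have i' := inner_move i h t0 tT; have bd' := inner_band i'.
have ex : x + t * wx - n%:~R * circ R s = left_x s (y + t * wy) + circ R s.
  by rewrite left_xD; lra.
have Dt : inD (tilex s true n (x + t * wx)) (tiley s true (y + t * wy)).
  by apply/tile_true => //; rewrite ex lexx right_le_left_circ.
have Df : inD (tilex s false (n + 1) (x + t * wx)) (tiley s false (y + t * wy)).
  apply/tile_false => //; have := left_le_right bd'; rewrite intrD; lra.
apply: (reaches_trans t0 (q := chart false (tilex s false (n + 1) (x + t * wx)) (y + t * wy))).
  have hp := tile_chord t0 D Dt; apply: path_same_r hp _; right; split.
    by move/cone_chart; apply: (@inner_noncorner _ s); apply: inner_tiley.
  apply/glued_chart; exists (left_side s); rewrite !ref_left_side; split=> //.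
    by apply/slack_left_side; rewrite /= left_x_mirror; lra.
  by rewrite /= intrD; congr chart; rewrite /mirror; lra.
have eT (z w : R) : z + t * w + (T - t) * w = z + T * w by lra.
apply: IH; rewrite ?eT //; first by lra.
rewrite intrD; move: r2 gt; rewrite -natr1; lra.
Qed.

Lemma right_false_all N : right_false N.
Proof.
elim: N => [|N IH] n x y T i T0 h D /andP[r1 r2]; have bd := inner_band i.
  apply: tile_reaches => //; apply/tile_false => //.
  by have := left_le_right h; lra.
have [le|gt] := lerP (x + T * wx - n%:~R * circ R s) (right_x s (y + T * wy)).
  by apply: tile_reaches => //; apply/tile_false => //; rewrite r1.
have /(tile_false n _ bd) D0 := D.
have [t [t0 tT te]] : exists t, [/\ 0 <= t, t < T &
    right_x s y - (x - n%:~R * circ R s) + t * (rslope R s * wy - wx) = 0].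
  by apply: first_zero => //; [lra | move: gt; rewrite right_xD; lra].
have i' := inner_move i h t0 tT; have bd' := inner_band i'.
have ex : x + t * wx - n%:~R * circ R s = right_x s (y + t * wy).
  by rewrite right_xD; lra.
have Dt : inD (tilex s false n (x + t * wx)) (tiley s false (y + t * wy)).
  by apply/tile_false => //; rewrite ex lexx left_le_right.
have Df : inD (tilex s true n (x + t * wx)) (tiley s true (y + t * wy)).
  by apply/tile_true => //; rewrite ex lexx right_le_left_circ.
apply: (reaches_trans t0 (q := chart true (tilex s true n (x + t * wx)) (mirror s (y + t * wy)))).
  have hp := tile_chord t0 D Dt; apply: path_same_r hp _; right; split.
    by move/cone_chart; apply: (@inner_noncorner _ s); apply: inner_tiley.
  apply/glued_chart; exists (right_side s); rewrite !ref_right_side; split=> //.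
    exact/slack_right_side.
  by rewrite /=; congr chart; rewrite /mirror; lra.
have eT (z w : R) : z + t * w + (T - t) * w = z + T * w by lra.
by apply: (right_true_of_false IH); rewrite ?eT //; [lra | rewrite (ltW gt)].
Qed.

Lemma arch_circ (a : R) : exists N : nat, a <= N%:R * circ R s.
Proof.
exists (Num.bound `|a / circ R s|); rewrite -ler_pdivrMr ?circ_gt0 //.
by apply/ltW/(le_lt_trans (ler_norm _))/Num.Theory.archi_boundP.
Qed.

End Right.

(** Starting inside the strip no vertex is met before the end, so that a segment
    of the strip can be followed on the surface tile by tile. *)
Lemma strip_path s wx wy x y p T : inner s y -> develops s x y p -> 0 <= T ->
  band s (y + T * wy) -> reaches s wx wy x y p T.
Proof.
move=> i [_ [b [n [-> D]]]] T0 h.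
have key b' n' x' y' ux uy : inner s y' -> band s (y' + T * uy) ->
    inD (tilex s b' n' x') (tiley s b' y') ->
    (if b' then right_x s (y' + T * uy) else left_x s (y' + T * uy)) <=
      x' + T * ux - n'%:~R * circ R s ->
    reaches s ux uy x' y' (chart b' (tilex s b' n' x') (tiley s b' y')) T.
  move=> i' h' D' le; have c0 := circ_gt0 R s.
  have [N hN] := arch_circ s (x' + T * ux - n'%:~R * circ R s - left_x s (y' + T * uy)).
  case: b' D' le => D' le.
    apply: (@right_true_of_false s ux uy N); [exact: right_false_all|by []..|].
    by rewrite le -natr1; lra.
  by apply: (@right_false_all s ux uy N); rewrite // le; lra.
pose e := x + T * wx - n%:~R * circ R s.
have [le|gt] := lerP (if b then right_x s (y + T * wy) else left_x s (y + T * wy)) e.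
  exact: key.
(* The end lies to the left of the tile: the involution turns the path around. *)
have [ex ey] := tile_flip s b n x y.
have := key (~~ b) (- n) (cen R s - x) (mirror s y) (- wx) (- wy).
have oy : mirror s y + T * - wy = mirror s (y + T * wy) by rewrite /mirror; lra.
rewrite oy ex ey => /(_ (inner_mirror i) (band_mirror h) D).
case=> [|q dq hq].
  have lr := left_le_right h; have rl := right_le_left_circ h.
  by case: b gt {D ex ey} => gt; rewrite /= ?left_x_mirror ?right_x_mirror mulrNz; rewrite /e in gt; lra.
exists (flip q); last first.
  by have := flip_path hq; rewrite !opprK flip_chart negbK.
by have := develops_flip dq; rewrite oy mirrorK (_ : cen R s - _ = x + T * wx) //; lra.
Qed.

Lemma strip_lift s wx wy p T q : straight_path (dir wx wy) p T q ->
  forall x y, inner s y -> develops s x y p -> inner s (y + T * wy) ->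
  develops s (x + T * wx) (y + T * wy) q.
Proof.
elim/path_chart_ind=> {p T q}.
  move=> b x0 y0 T T0 D0 D1 x y i [_ [b' [n [/chart_inj [<- ex ey] _]]]] i'.
  split; first exact: inner_band.
  have e1 : x0 + T * (sg R b * wx) = tilex s b n (x + T * wx).
    by rewrite ex /tilex /sg; case: b {D0 D1 ex ey}; rewrite ?expr0 ?expr1; lra.
  have e2 : y0 + T * (sg R b * wy) = tiley s b (y + T * wy).
    by rewrite ey /tiley /sg /mirror; case: b {D0 D1 ex ey e1}; rewrite ?expr0 ?expr1; lra.
  by exists b, n; rewrite -e1 -e2.
move=> p q q' r t u h1 IH1 n g h2 IH2 x y i d i'.
have t0 := path_ge0 h1; have u0 := path_ge0 h2.
have im : inner s (y + t * wy).
  move: i i'; rewrite /inner => /andP[i1 i2] /andP[i3 i4].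
  have [w|w] := lerP 0 wy.
    have e1 : 0 <= t * wy by rewrite mulr_ge0.
    have e2 : 0 <= u * wy by rewrite mulr_ge0.
    by apply/andP; split; lra.
  have e1 : t * wy <= 0 by rewrite mulr_ge0_le0 // ltW.
  have e2 : u * wy <= 0 by rewrite mulr_ge0_le0 // ltW.
  by apply/andP; split; lra.
rewrite !mulrDl !addrA; apply: IH2 => //; last by rewrite -addrA -mulrDl.
by apply: develops_same im (IH1 _ _ i d im) _; right.
Qed.

End StripPaths.

(** * The Dehn twist of the two horizontal cylinders *)

Section Twist.
Variable R : realType.
Local Notation f := (phi R).
Implicit Types (p q r : pt R) (b s : bool) (J : 'I_5) (x y t : R) (v : 'cV[R]_2).
Implicit Types (n k d : int).

Lemma develops_chart s b x y : inD x y -> band s y ->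
  develops s (tilex s b 0 x) (tiley s b y) (chart b x y).
Proof.
move=> D h; split; first exact: band_tiley.
exists b, 0; have -> : tilex s b 0 (tilex s b 0 x) = x.
  by case: b => /=; rewrite mul0r; lra.
by have -> : tiley s b (tiley s b y) = y by case: b => //=; rewrite mirrorK.
Qed.

Lemma inD_band x y : inD x y -> exists s, band s y.
Proof.
have p2 := phi_sq R; have pb := phi_bounds R; have p0 := phi_gt0 R.
move=> /inDP [h1 h2 h3 h4 h5].
have y1 : y <= f + 1.
  by rewrite -(ler_pM2l p0) mulrDr p2; lra.
by have [h|h] := lerP y f; [exists false | exists true]; rewrite /band /bot /top; lra.
Qed.

Lemma valid_develops p : valid p -> exists s x y, develops s x y p.
Proof.
move=> [b [x [y [-> D]]]]; have [s h] := inD_band D.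
by exists s, (tilex s b 0 x), (tiley s b y); apply: develops_chart.
Qed.

(** A start on the boundary is reached backwards from the middle of the segment.
    Only a segment inside the boundary is excluded: vertices may obstruct it. *)
Lemma strip_path_closed s wx wy x y p T : regular p -> develops s x y p -> 0 <= T ->
  band s (y + T * wy) -> inner s y \/ T * wy != 0 -> reaches s wx wy x y p T.
Proof.
move=> [V n] dp T0 h; have [i _|ni [//|w0]] := pselect (inner s y).
  exact: strip_path.
have [by_ _] := dp.
(* The two heights are distinct and lie in the closed strip, so their mean lies
   inside. *)
have im : inner s (y + T / 2 * wy).
  move: by_ ni h w0; rewrite /band /inner => b1 ni h w0.
  rewrite (_ : T / 2 * wy = T * wy / 2); last by lra.
  move: (T * wy) h w0 => u h w0.
  have [yb|yb] := eqVneq y (bot R s).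
    by apply/andP; split; move: w0; rewrite neq_lt => /orP[]; lra.
  have [yt|yt] := eqVneq y (top R s).
    by apply/andP; split; move: w0; rewrite neq_lt => /orP[]; lra.
  by case: ni; move: b1; rewrite !lt_neqAle yt (eq_sym _ y) yb.
have [m dm] := develops_total (x + T / 2 * wx) (inner_band im).
have T2 : 0 <= T / 2 by lra.
have eT (z w : R) : z + T / 2 * w + T / 2 * - w = z by lra.
have [] := @strip_path _ s (- wx) (- wy) _ _ m (T / 2) im dm T2; rewrite ?eT //.
move=> p1 d1 /path_rev; rewrite dirN !opprK => h1.
have {h1} h1 : straight_path (dir wx wy) p (T / 2) m.
  apply: path_same_l h1; by case: (develops_uniq dp d1) => // -[].
apply: (reaches_trans T2 h1); apply: strip_path => //; first by lra.
by rewrite (_ : y + _ * wy + _ = y + T * wy) //; lra.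
Qed.

Variable d : int.

(** The d-th power of the twist; negative powers give the inverse. It is the
    identity on the lower boundary of the strip. *)
Definition shear s x y : R := x + d%:~R * f * (y - bot R s).

Lemma shear_step s x y wx wy T :
  shear s (x + T * wx) (y + T * wy) = shear s x y + T * (wx + d%:~R * f * wy).
Proof. by rewrite /shear; lra. Qed.

(** On the upper boundary the shear is a deck translation, because the ratio of
    circumference to height is phi for both cylinders. *)
Lemma shear_edge s x y : band s y -> ~ inner s y ->
  exists k, shear s x y = x + k%:~R * circ R s.
Proof.
have p2 := phi_sq R; rewrite /band /inner => h ni.
have [yb|yb] := eqVneq y (bot R s).
  by exists 0; rewrite /shear yb; lra.
have [yt|yt] := eqVneq y (top R s); last first.
  by case: ni; move: h; rewrite !lt_neqAle yt (eq_sym _ y) yb.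
exists d; rewrite /shear yt -mulrA; congr (_ + _ * _).
by rewrite /top /bot /circ; case: s {yb yt h ni}; lra.
Qed.

Lemma develops_shiftN s x y p k : develops s (x + k%:~R * circ R s) y p -> develops s x y p.
Proof.
by move=> /(develops_shift (- k)); rewrite mulrNz mulNr addrK.
Qed.

Lemma edge_develops s x y p : ~ inner s y -> develops s (shear s x y) y p <-> develops s x y p.
Proof.
move=> ni; split=> [h|h]; have [k e] := shear_edge x h.1 ni.
  by rewrite e in h; apply: develops_shiftN h.
by rewrite e; apply: develops_shift.
Qed.

Lemma edge_same s x y p p' : ~ inner s y -> develops s x y p -> develops s (shear s x y) y p' ->
  same p p' \/ cone p /\ cone p'.
Proof. by move=> ni h /(edge_develops _ _ ni); apply: develops_uniq. Qed.

Definition twists p p' : Prop :=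
  exists s x y, develops s x y p /\ develops s (shear s x y) y p'.

Lemma twists_cone p p' : twists p p' -> cone p <-> cone p'.
Proof.
move=> [s [x [y [h h']]]]; have [i|ni] := pselect (inner s y).
  by split=> c; [case: (develops_noncone i h) | case: (develops_noncone i h')].
case: (edge_same ni h h') => [sm|[]]; last by split.
by split; apply: same_cone => //; apply: same_sym.
Qed.

Lemma twists_valid p p' : twists p p' -> valid p /\ valid p'.
Proof. by move=> [s [x [y [h h']]]]; split; apply: develops_valid; eassumption. Qed.

Lemma twists_regular p p' : twists p p' -> regular p -> regular p'.
Proof.
move=> h [_ n]; split; first by case: (twists_valid h).
by move/(twists_cone h).
Qed.

(** A point on the common boundary of the cylinders lies in both strips, and the
    twist fixes it in either. *)
Lemma twists_strip p p' s x y : regular p -> twists p p' -> develops s x y p ->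
  exists2 p'', same p'' p' & develops s (shear s x y) y p''.
Proof.
move=> [_ n] [s' [x' [y' [h h']]]] dp.
have [e|ss] := eqVneq s' s.
  subst s'; have [<- [k ->]] := develops_fiber h dp; exists p'; first exact: same_refl.
  have -> : shear s (x' + k%:~R * circ R s) y' = shear s x' y' + k%:~R * circ R s.
    by rewrite /shear; lra.
  exact: develops_shift.
have [ni ni'] : ~ inner s y /\ ~ inner s' y'.
  case: (h) (dp) => hb' [b [m [-> _]]] [hb [b' [k [/chart_inj [<- _ ey] _]]]].
  move: ss (band_tiley b hb') (band_tiley b hb) ey; rewrite /inner /band => ss w w' ey.
  have [wf wf'] : tiley s b y = f /\ tiley s' b y' = f.
    move: ss w w' ey; case: s {dp h h' hb hb'}; case: s' => // _; rewrite /bot /top; lra.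
  split=> /(inner_tiley b); rewrite ?wf ?wf' /inner /bot /top.
    by case: s {dp hb ss w w' ey wf wf'}; lra.
  by case: s' {h h' hb' ss w w' ey wf wf'}; lra.
exists p; last by apply/edge_develops.
by case: (edge_same ni' h h') => // -[].
Qed.

Lemma twists_uniq p p' p'' : regular p -> twists p p' -> twists p p'' -> same p' p''.
Proof.
move=> rp h [s [x [y [h1 h2]]]]; have [q sq dq] := twists_strip rp h h1.
apply: same_trans (same_sym sq) _.
have [//|[cq]] := develops_uniq dq h2.
have [_ n] : regular q by apply: twists_regular rp; exists s, x, y.
by [].
Qed.

Lemma twists_total p : valid p -> exists p', twists p p'.
Proof.
move=> /valid_develops [s [x [y h]]]; have [p' h'] := develops_total (shear s x y) h.1.
by exists p', s, x, y.
Qed.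

Lemma twists_same p q p' : regular p -> twists p p' -> same p q ->
  exists2 q', same p' q' & twists q q'.
Proof.
move=> rp h sm; have rq := same_regular rp sm.
have [s [x [y dq]]] := valid_develops rq.1.
have [i|ni] := pselect (inner s y).
  have dp := develops_same i dq (same_sym sm).
  have [q' sq dq'] := twists_strip rp h dp.
  by exists q'; [apply: same_sym | exists s, x, y].
case: h => s' [x' [y' [dp dp']]]; have [i'|ni'] := pselect (inner s' y').
  by exists p'; [apply: same_refl | exists s', x', y'; split=> //; apply: develops_same sm].
exists q; last by exists s, x, y; split=> //; apply/edge_develops.
case: (edge_same ni' dp dp') => [/same_sym sp|[c _]]; first exact: same_trans sm.
by case: rp.
Qed.

Section Direction.
Variables wx wy : R.
Let wx' := wx + d%:~R * f * wy.

Definition twist_reaches p' T q : Prop :=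
  exists2 q', twists q q' & straight_path (dir wx' wy) p' T q'.

(** A chord inside the boundary of a strip, where the strip gives no paths, is
    fixed by the twist together with its direction. *)
Lemma twist_chord_strip s b x y T p' : 0 <= T -> inD x y ->
  inD (x + T * (sg R b * wx)) (y + T * (sg R b * wy)) ->
  band s y -> band s (y + T * (sg R b * wy)) ->
  regular (chart b x y) -> twists (chart b x y) p' ->
  twist_reaches p' T (chart b (x + T * (sg R b * wx)) (y + T * (sg R b * wy))).
Proof.
move=> T0 D D' h h' rp tp; have dp := develops_chart b D h; have dq := develops_chart b D' h'.
have ex : tilex s b 0 (x + T * (sg R b * wx)) = tilex s b 0 x + T * wx.
  by rewrite /tilex /sg; case: b {D' h' rp tp dp dq}; rewrite ?expr0 ?expr1; lra.
have ey : tiley s b (y + T * (sg R b * wy)) = tiley s b y + T * wy.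
  by rewrite /tiley /sg /mirror; case: b {D' h' rp tp dp dq ex}; rewrite ?expr0 ?expr1; lra.
rewrite {}ex {}ey in dq; have [p1 s1 d1] := twists_strip rp tp dp.
have rp1 : regular p1 by apply: twists_regular (rp); do 3!eexists; split; eassumption.
(* The strip provides the image unless the chord is horizontal and lies in the
   boundary; a horizontal chord has the same direction after the shear. *)
have [e|w0] := eqVneq (T * wy) 0; last first.
  have [q' dq' hq'] := strip_path_closed wx' rp1 d1 T0 dq.1 (or_intror w0).
  exists q'; last by apply: path_same_l hq'; apply: same_sym.
  by exists s, (tilex s b 0 x + T * wx), (tiley s b y + T * wy); rewrite shear_step.
have [i|ni] := pselect (inner s (tiley s b y)).
  have [q' dq' hq'] := strip_path_closed wx' rp1 d1 T0 dq.1 (or_introl i).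
  exists q'; last by apply: path_same_l hq'; apply: same_sym.
  by exists s, (tilex s b 0 x + T * wx), (tiley s b y + T * wy); rewrite shear_step.
exists (chart b (x + T * (sg R b * wx)) (y + T * (sg R b * wy))).
  exists s, (tilex s b 0 x + T * wx), (tiley s b y + T * wy); split=> //.
  by apply/edge_develops; rewrite ?e ?addr0 // in dq *.
have sp : same p' (chart b x y).
  apply: same_trans (same_sym s1) _; apply: same_sym.
  by case: (edge_same ni dp d1) => // -[c _]; case: rp.
apply: path_same_l sp _.
have ew a : T * (a * wx') = T * (a * wx).
  have -> : T * (a * wx') = T * (a * wx) + a * (d%:~R * f) * (T * wy) by rewrite /wx'; ring.
  by rewrite e mulr0 addr0.
by have := @chord R b wx' wy x y T T0 D; rewrite !ew; apply.
Qed.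

(** A chord that does not stay in one strip is cut at height phi, at an interior
    point of the chord, hence not a vertex. *)
Lemma twist_chord b x y T p' : 0 <= T -> inD x y ->
  inD (x + T * (sg R b * wx)) (y + T * (sg R b * wy)) ->
  regular (chart b x y) -> twists (chart b x y) p' ->
  twist_reaches p' T (chart b (x + T * (sg R b * wx)) (y + T * (sg R b * wy))).
Proof.
move=> T0 D D' rp tp; have [s h] := inD_band D; have [s' h'] := inD_band D'.
have [hb|nh] := pselect (band s (y + T * (sg R b * wy))).
  exact: (twist_chord_strip T0 D D' h hb rp tp).
have [hb|nh'] := pselect (band s' y); first exact: (twist_chord_strip T0 D D' hb h' rp tp).
pose u := sg R b * wy.
(* The chord crosses the horizontal diagonal at time t. *)
have [t [t0 tT ft]] : exists t, [/\ 0 < t, t < T & y + t * u = f].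
  move: h h' nh nh'; rewrite -/u => h h' nh nh'.
  have yf : (y < f /\ f < y + T * u) \/ (f < y /\ y + T * u < f).
    move: h h' nh nh'; rewrite /band /bot /top; case: s; case: s' => h h' nh nh'.
    - by case: nh.
    - right; split; rewrite ltNge; apply/negP => ?; [apply: nh' | apply: nh]; lra.
    - left; split; rewrite ltNge; apply/negP => ?; [apply: nh' | apply: nh]; lra.
    - by case: nh.
  have u0 : u != 0 by apply/eqP => u0; move: yf; rewrite u0 mulr0; lra.
  exists ((f - y) / u); case: yf => -[y1 y2].
    have up : 0 < u.
      by rewrite ltNge; apply/negP => un; have := mulr_ge0_le0 T0 un; lra.
    by split; rewrite ?divr_gt0 ?ltr_pdivrMr ?divfK //; lra.
  have up : u < 0.
    by rewrite ltNge; apply/negP => un; have := mulr_ge0 T0 un; lra.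
  split; rewrite ?ltr_ndivrMr ?divfK //; try lra.
  by rewrite nmulr_lgt0 ?invr_lt0 //; lra.
have u0 : wy != 0.
  apply/eqP => w0; apply: nh; move: h; rewrite w0 mulr0 mulr0 addr0; exact.
have Dm : inD (x + t * (sg R b * wx)) (y + t * (sg R b * wy)).
  by apply: inD_between D D' _; rewrite (ltW t0) ltW.
have hf (s0 : bool) : band s0 (y + t * (sg R b * wy)).
  by have pb := phi_bounds R; rewrite -/u ft /band /bot /top; case: s0; lra.
have rm : regular (chart b (x + t * (sg R b * wx)) (y + t * (sg R b * wy))).
  split; first by do 3!eexists; split; first reflexivity.
  move/cone_chart => c; move/eqP: u0; apply.
  by apply: (corner_extreme D D' _ c).2; rewrite t0.
have [m' tm hm] := twist_chord_strip (ltW t0) D Dm h (hf s) rp tp.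
have Tt : 0 <= T - t by lra.
have eT (z w : R) : z + t * w + (T - t) * w = z + T * w by lra.
have := @twist_chord_strip s' b _ _ (T - t) m' Tt Dm; rewrite !eT.
move=> /(_ D' (hf s') h' rm tm) [q' tq hq]; exists q' => //.
have -> : T = t + (T - t) by lra.
exact: path_cat hm hq.
Qed.

Lemma twist_path p T q : straight_path (dir wx wy) p T q ->
  forall p', regular p -> twists p p' -> twist_reaches p' T q.
Proof.
elim/path_chart_ind=> {p T q}.
  by move=> b x y T T0 D D' p' rp tp; apply: twist_chord.
move=> p q q' r t u h1 IH1 n g h2 IH2 p' rp tp.
have [q1 tq hq] := IH1 p' rp tp.
have rq : regular q by split=> //; case: (path_valid h1).
have sq : same q q' by right.
have [q1' sq' tq'] := twists_same rq tq sq.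
have [r' tr hr] := IH2 q1' (same_regular rq sq) tq'.
by exists r' => //; apply: path_cat hq (path_same_l sq' hr).
Qed.

End Direction.

Definition shear_mx : 'M[R]_2 := mx2 1 (d%:~R * f) 0 1.

Definition twist_rel p p' : Prop := regular p /\ twists p p'.

Lemma twist_carries : carries (conjP shear_mx) twist_rel.
Proof.
split.
- by move=> p p' [rp tp]; split=> //; apply: twists_regular tp rp.
- by move=> p rp; have [p' tp] := twists_total rp.1; exists p'.
- move=> v p t q p' q' h [rp tp] [rq tq]; have [a [c E]] := dir_surj v.
  rewrite {}E conjP_dir mul1r mul0r mul1r add0r in h *.
  have [q1 tq1 h1] := twist_path h rp tp.
  exact: path_same_r h1 (twists_uniq rq tq1 tq).
- move=> v p t q p' h cq [rp tp]; have [a [c E]] := dir_surj v.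
  rewrite {}E conjP_dir mul1r mul0r mul1r add0r in h *.
  have [q1 tq1 h1] := twist_path h rp tp; exists q1 => //.
  exact/(twists_cone tq1).
Qed.

End Twist.

(** * The twist as an affine automorphism *)

Section TwistIso.
Variable R : realType.
Local Notation f := (phi R).

Lemma shear_mx_mul (d : int) : shear_mx R (- d) *m shear_mx R d = 1%:M.
Proof. by rewrite mx2_mul -mx2_1; congr mx2; rewrite ?mulrNz; lra. Qed.

Lemma twist_rel_converse (d : int) : converse (twist_rel d) = twist_rel (- d) :> (pt R -> pt R -> Prop).
Proof.
have half (e : int) p p' : @twist_rel R e p p' -> twist_rel (- e) p' p.
  move=> [rp tp]; split; first exact: twists_regular tp rp.
  case: tp => s [x [y [h h']]]; exists s, (shear e s x y), y; split=> //.
  by rewrite (_ : shear (- e) s _ y = x) // /shear mulrNz; lra.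
apply/funext => p; apply/funext => p'; apply/propext; split; first exact: half.
by move/half; rewrite opprK.
Qed.

Lemma twist_iso (d : int) : affine_iso (conjP (shear_mx R d)) (twist_rel d).
Proof.
have [u e] : conjP (shear_mx R d) \in unitmx /\ invmx (conjP (shear_mx R d)) = conjP (shear_mx R (- d)).
  by apply: conjP_unit; first exact: shear_mx_mul; have := shear_mx_mul (- d); rewrite opprK.
by split; rewrite ?e ?twist_rel_converse //; apply: twist_carries.
Qed.

Definition twist_side (J : 'I_5) : 'I_5 :=
  match val J with
  | 0%N => lbl 2 | 1%N => lbl 1 | 2%N => lbl 4 | 3%N => lbl 3 | _ => lbl 5
  end.

Lemma twist_sideE : (twist_side (lbl 1) = lbl 2) * (twist_side (lbl 2) = lbl 1) *
  (twist_side (lbl 3) = lbl 4) * (twist_side (lbl 4) = lbl 3) *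
  (twist_side (lbl 5) = lbl 5).
Proof. by rewrite /twist_side /lbl !valK5. Qed.

Lemma twist_rel_midpoint J : twist_rel 1 (side_midpoint R J) (side_midpoint R (twist_side J)).
Proof.
have p2 := phi_sq R; have pb := phi_bounds R.
split; first exact: midpoint_regular.
have [V _] := midpoint_regular R J; have [V' _] := midpoint_regular R (twist_side J).
rewrite /side_midpoint !midpointE !chartF in V V' *.
move: (midpoint_inD R J) (midpoint_inD R (twist_side J)).
have key s n J' K : band s (refy R J' / 2) -> refy R K = refy R J' ->
    shear 1 s (refx R J' / 2) (refy R J' / 2) - n%:~R * circ R s = refx R K / 2 ->
    inD (refx R J' / 2) (refy R J' / 2) -> inD (refx R K / 2) (refy R K / 2) ->
    twists 1 (chart false (refx R J' / 2) (refy R J' / 2))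
             (chart false (refx R K / 2) (refy R K / 2)).
  move=> h ey ex D D'; exists s, (refx R J' / 2), (refy R J' / 2).
  split; split=> //; exists false; [exists 0 | exists n].
    by rewrite /tilex /tiley mul0r subr0.
  by rewrite /tilex /tiley ex -ey.
elim/ord5_ind: J {V V'}; rewrite twist_sideE.
- by apply: (@key true 0); rewrite !refE /band /shear /bot /top /circ; lra.
- by apply: (@key true 1); rewrite !refE /band /shear /bot /top /circ; lra.
- by apply: (@key false 0); rewrite !refE /band /shear /bot /top /circ; lra.
- by apply: (@key false 1); rewrite !refE /band /shear /bot /top /circ; lra.
- by apply: (@key false 0); rewrite !refE /band /shear /bot /top /circ; lra.
Qed.

End TwistIso.

(** * The horizontal direction *)

Section Horizontal.
Variable R : realType.
Local Notation f := (phi R).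
Implicit Types (p q r : pt R) (b s : bool) (J : 'I_5) (x y t : R) (v : 'cV[R]_2).
Variable l : R.
Hypothesis l0 : 0 < l.

Definition hcyl s : set (pt R) := [set p | exists x y, inner s y /\ develops s x y p].

Lemma hcyl_regular s p : hcyl s p -> regular p.
Proof.
by move=> [x [y [i h]]]; split; [apply: develops_valid h | apply: develops_noncone i h].
Qed.

Lemma hcyl_trajectory s p : hcyl s p -> trajectory (dir l 0) p `<=` hcyl s.
Proof.
move=> [x [y [i h]]] q [n [t [hp|/path_rev]]].
  exists (x + t * l), (y + t * 0); split; first by rewrite mulr0 addr0.
  by apply: (strip_lift hp i h); rewrite mulr0 addr0.
rewrite dirN => hp; exists (x + t * - l), (y + t * - 0); split.
  by rewrite oppr0 mulr0 addr0.
by apply: (strip_lift hp i h); rewrite oppr0 mulr0 addr0.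
Qed.

(** A closed path lifts to a segment of the strip whose end points differ by a
    positive multiple of the circumference. *)
Lemma hcyl_period s p : hcyl s p -> least_period (dir l 0) p (circ R s / l).
Proof.
move=> /[dup] /hcyl_regular [_ n] [x [y [i h]]]; have c0 := circ_gt0 R s.
have T0 : 0 < circ R s / l by rewrite divr_gt0.
split=> //.
  have [|q dq hq] := @strip_path _ s l 0 _ _ _ _ i h (ltW T0).
    by rewrite mulr0 addr0; apply: inner_band.
  apply: path_same_r hq _; apply: same_sym.
  have {}dq : develops s x y q.
    apply: (@develops_shiftN _ s x y q 1); move: dq.
    by rewrite mulr0 addr0 divfK ?gt_eqF // mul1r.
  by case: (develops_uniq h dq) => // -[].
move=> T T0' hp; have := strip_lift hp i h.
rewrite mulr0 addr0 => /(_ i) h'; have [_ [k e]] := develops_fiber h h'.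
have ek : T * l = k%:~R * circ R s by lra.
have : 0 < k%:~R * circ R s by rewrite -ek mulr_gt0.
rewrite pmulr_lgt0 // ltr0z gtz0_ge1 => k1.
rewrite ler_pdivrMr // ek; apply: ler_peMl; first exact: ltW.
by rewrite -[1]/(1%:~R) ler_int.
Qed.

Lemma hcyl_connected s p q : hcyl s p -> hcyl s q ->
  exists h, straight_path h p 1 q /\ on_path h p 1 q `<=` hcyl s.
Proof.
move=> [x [y [i dp]]] /[dup] /hcyl_regular [_ nq] [x' [y' [i' dq]]].
exists (dir (x' - x) (y' - y)).
have e (a c : R) : a + 1 * (c - a) = c by lra.
split.
  have [|q1 dq1 hq] := @strip_path _ s (x' - x) (y' - y) _ _ _ _ i dp ler01.
    by rewrite e; apply: inner_band.
  rewrite !e in dq1; apply: path_same_r hq _.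
  by case: (develops_uniq dq dq1) => [/same_sym//|[]].
move=> r [t [/andP[t0 t1] hr _]].
have im : inner s (y + t * (y' - y)).
  move: i i'; rewrite /inner => /andP[i1 i2] /andP[i3 i4].
  have [yy|yy] := lerP y y'.
    have h1 : 0 <= t * (y' - y) by rewrite mulr_ge0 // subr_ge0.
    have h2 : t * (y' - y) <= y' - y by rewrite ler_piMl // subr_ge0.
    by apply/andP; split; lra.
  have h1 : 0 <= t * (y - y') by rewrite mulr_ge0 // subr_ge0 ltW.
  have h2 : t * (y - y') <= y - y' by rewrite ler_piMl // subr_ge0 ltW.
  by apply/andP; split; lra.
exists (x + t * (x' - x)), (y + t * (y' - y)); split=> //.
exact: (strip_lift hr i dp im).
Qed.

Lemma hcyl_nonempty s : hcyl s !=set0.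
Proof.
have pb := phi_bounds R.
have i : inner s ((bot R s + top R s) / 2).
  by rewrite /inner /bot /top; case: s; lra.
have [p dp] := develops_total 0 (inner_band i).
by exists p, 0, ((bot R s + top R s) / 2).
Qed.

Lemma hcyl_family s : parallel_family (dir l 0) (hcyl s).
Proof.
split; first exact: hcyl_nonempty.
- move=> p cp; have [T0 h _] := hcyl_period cp.
  by split; [case: (hcyl_regular cp) | exists (circ R s / l)].
- exact: hcyl_trajectory.
- exact: hcyl_connected.
Qed.

(** Along the horizontal side and the horizontal diagonal a path never leaves its
    line; the only gluing met is the one along side 5. *)
Lemma edge_lift p t q : straight_path (dir l 0) p t q -> forall b x y,
  y = 0 \/ y = f -> same (chart b x y) p -> ~ cone p -> ~ cone q ->
  same (chart b (x + t * (sg R b * l)) y) q.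
Proof.
have p2 := phi_sq R; have pb := phi_bounds R.
elim/path_chart_ind=> {p t q}; last first.
  move=> p q q' r t u _ IH1 n g _ IH2 b x y ey sm np nr.
  have sq := IH1 b x y ey sm np n.
  have sq' : same q q' by right.
  rewrite mulrDl addrA; apply: IH2 => //; first exact: same_trans sq sq'.
  by move=> c; apply: n; apply: same_cone (same_sym sq') c.
move=> b0 x0 y0 t t0 D0 D1 b x y ey sm np nq.
rewrite mulr0 mulr0 addr0 in D1 nq *.
case: sm => [/chart_inj [<- <- <-]|[n /glued_chart [J [D e]]]]; first exact: same_refl.
move=> /chart_inj [eb ex0 ey0]; subst b0 x0 y0.
have EJ : J = lbl 5 /\ y = 0.
  case: ey => ey; first by split=> //; apply: (regular_side n D e); rewrite slackE.
  case: n; apply/cone_chart/corner_cases; rewrite ey in e *.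
  have fx : f * (f * x) = f * x + x by rewrite mulrA p2; lra.
  have ff : f * (f * f) = f * f + f by rewrite {1}p2; lra.
  have e' := congr1 ( *%R f) e.
  suff : x = 0 \/ x = f by rewrite !inE !xpair_eqE => -[] ->; rewrite !eqxx ?orbT.
  move: e e'; elim/ord5_ind: J {D0 D D1 np nq}; rewrite slackE => e e'.
  - by left; lra.
  - by right; lra.
  - by left; lra.
  - by right; lra.
  - by exfalso; lra.
case: EJ => EJ y0; subst J y.
apply: same_sym; right; split=> //; apply/glued_chart; exists (lbl 5).
rewrite !refE sgN ?subr0 in D1; rewrite negbK slackE !refE sgN ?subr0.
by split=> //; congr chart; lra.
Qed.

(** On the boundary of the cylinders the abscissa grows strictly along a path, so
    no trajectory closes up. *)
Lemma edge_not_closed s x y p : ~ inner s y -> develops s x y p -> ~ closed_at (dir l 0) p.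
Proof.
have pb := phi_bounds R.
move=> ni [h [b [n [-> D]]]] [nc [T T0 hp]].
have {ni h} ey : tiley s b y = 0 \/ tiley s b y = f \/ tiley s b y = f + 1.
  have : y = bot R s \/ y = top R s.
    move: ni h; rewrite /inner /band => ni h.
    have [yb|yb] := eqVneq y (bot R s); first by left.
    have [yt|yt] := eqVneq y (top R s); first by right.
    by case: ni; move: h; rewrite !lt_neqAle yt (eq_sym _ y) yb.
  rewrite /tiley /mirror /bot /top; case: s {D hp nc h ni}; case: b => -[] ->.
  - by right; right; lra.
  - by right; left; lra.
  - by right; left; lra.
  - by right; right; lra.
  - by right; left; lra.
  - by left; lra.
  - by left; lra.
  - by right; left; lra.
move: (tilex s b n x) (tiley s b y) D nc hp ey => u w D nc hp ey.
have {}ey : w = 0 \/ w = f.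
  case: ey => [->|[->|ew]]; [by left | by right | case: nc].
  apply/cone_chart/corner_cases; move: D; rewrite ew => /inDP [h1 h2 _ _ _].
  rewrite (_ : u = 0) ?inE ?eqxx ?orbT //; have := phi_sq R; lra.
case: (edge_lift hp ey (same_refl _) nc nc) => [/chart_inj [_ e _]|[_]].
  have : T * (sg R b * l) = 0 by lra.
  move/eqP; rewrite !mulf_eq0 (gt_eqF T0) (gt_eqF l0) orbF /= => /eqP sb.
  by have := sgsg R b; rewrite sb mulr0; lra.
by case/glued_chart=> J [_ _ /chart_inj [/esym]]; case: b {D nc hp}.
Qed.

(** A segment that leaves the cylinder first meets its boundary, whose points are
    not on closed trajectories. *)
Lemma family_in_hcyl s C p : parallel_family (dir l 0) C -> C p -> hcyl s p ->
  C `<=` hcyl s.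
Proof.
move=> [_ closed _ conn] Cp [x [y [i dp]]] q Cq.
have [h [hp hC]] := conn p q Cp Cq.
have [hx [hy E]] := dir_surj h; subst h.
have [i'|ni] := pselect (inner s (y + 1 * hy)).
  by exists (x + 1 * hx), (y + 1 * hy); split=> //; apply: (strip_lift hp i dp i').
exfalso; rewrite mul1r in ni.
(* The segment first reaches the boundary of the strip at time t. *)
have [t [t0 t1 nt ht hy0]] : exists t, [/\ 0 < t, t <= 1, ~ inner s (y + t * hy),
    band s (y + t * hy) & hy != 0].
  move: i ni; rewrite /inner => /andP[i1 i2] ni.
  have hy0 : hy != 0 by apply/eqP => h0; apply: ni; rewrite h0 addr0 i1.
  have [hpos|hneg|h0] := ltgtP 0 hy; last by rewrite -h0 eqxx in hy0.
    have e : (top R s - y) / hy * hy = top R s - y by rewrite divfK.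
    exists ((top R s - y) / hy); rewrite /band e; split=> //.
    - by rewrite divr_gt0 //; lra.
    - rewrite ler_pdivrMr // mul1r leNgt; apply/negP => ?; apply: ni; lra.
    - lra.
    - lra.
  have e : (bot R s - y) / hy * hy = bot R s - y by rewrite divfK.
  exists ((bot R s - y) / hy); rewrite /band e; split=> //.
  - by rewrite nmulr_lgt0 ?invr_lt0 //; lra.
  - rewrite ler_ndivrMr // mul1r leNgt; apply/negP => ?; apply: ni; lra.
  - lra.
  - lra.
have [r dr hr] := strip_path hx i dp (ltW t0) ht.
have [nq _] := closed _ Cq.
have nr : ~ cone r.
  move=> c; move: t1; rewrite le_eqVlt => /orP[/eqP t1|t1].
    rewrite t1 in hr; have h1 := path_continue hp hr (lexx 1) nq.
    rewrite subrr in h1; apply: nq; apply: same_cone c; apply: same_sym.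
    by apply: path_null h1 _; rewrite scale0r.
  have : dir hx hy = 0 :> 'cV[R]_2 by apply: path_stops_at_cone hr hp _ c; rewrite t0.
  by rewrite -(dir00 R) => /dir_inj [_ /eqP]; apply/negP.
apply: (edge_not_closed nt dr); apply: closed; apply: hC.
exists t; split=> //; first by rewrite ltW.
exact: path_continue hr _ _ hp t1 nr.
Qed.

Lemma hcyl_cylinder s : cylinder (dir l 0) (hcyl s).
Proof.
split; first exact: hcyl_family.
move=> C fam sub; apply/seteqP; split=> //.
by have [p cp] := hcyl_nonempty s; apply: (family_in_hcyl fam (sub _ cp) cp).
Qed.

Lemma hcyl_circumference s :
  circumference (dir l 0) (hcyl s) (circ R s / l * enorm (dir l 0)).
Proof. by move=> p /hcyl_period h; exists (circ R s / l). Qed.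

(** Each closed trajectory lies in one of the two open cylinders, so a maximal
    family is one of them. *)
Lemma hcyl_long_short : long_short_cylinders (dir l 0) (hcyl false) (hcyl true).
Proof.
split; try exact: hcyl_cylinder.
  move=> C [fam max]; have [[p Cp] closed _ _] := fam.
  have [s [x [y dp]]] := valid_develops (closed_regular (closed _ Cp)).1.
  have i : inner s y.
    have [//|ni] := pselect (inner s y).
    by case: (edge_not_closed ni dp (closed _ Cp)).
  have cp : hcyl s p by exists x, y.
  have <- := max _ (hcyl_family s) (family_in_hcyl fam Cp cp).
  by case: s {dp i cp}; [right | left].
exists (circ R true / l * enorm (dir l 0)); split; last exact: hcyl_circumference.
rewrite mulrA mulrA (_ : f * circ R true = circ R false); last exact: phi_sq.
exact: hcyl_circumference.
Qed.

Lemma midpoint_hcyl s J : inner s (refy R J / 2) -> hcyl s (side_midpoint R J).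
Proof.
move=> i; exists (refx R J / 2), (refy R J / 2); split=> //.
rewrite /side_midpoint midpointE chartF.
have := @develops_chart _ s false _ _ (midpoint_inD R J) (inner_band i).
by rewrite /tilex mul0r subr0.
Qed.

Lemma horizontal_fate J : fate J (dir l 0) (side_midpoint R J).
Proof.
have pb := phi_bounds R; have p2 := phi_sq R; split.
- rewrite !inE => EJ; exists (hcyl false), (hcyl true); split; first exact: hcyl_long_short.
  apply: hcyl_trajectory; apply: midpoint_hcyl.
  by rewrite /inner /bot /top; case/orP: EJ => /eqP ->; rewrite !refE; lra.
- rewrite !inE => EJ; exists (hcyl false), (hcyl true); split; first exact: hcyl_long_short.
  apply: hcyl_trajectory; apply: midpoint_hcyl.
  by rewrite /inner /bot /top; case/orP: EJ => /eqP ->; rewrite !refE; lra.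
- move=> ->; have [_ n] := midpoint_regular R (lbl 5).
  have D := midpoint_inD R (lbl 5).
  rewrite /side_midpoint midpointE chartF !refE mul0r in n D *.
  have i2 : 0 <= 2^-1 / l by rewrite divr_ge0 ?invr_ge0 // ltW.
  have el (a : R) : a + 2^-1 / l * (1 * l) = a + 2^-1 by rewrite mul1r divfK ?gt_eqF.
  have e0 : (0 : R) + 2^-1 / l * (1 * 0) = 0 by rewrite !mulr0 addr0.
  have c0 : corner f 0 by apply/corner_cases; rewrite inE eqxx.
  have c1 : corner (f + 1) 0 by apply/corner_cases; rewrite !inE eqxx orbT.
  apply: (@saddle_through _ _ (chart false f 0) (2^-1 / l) _ (2^-1 / l) (chart false (f + 1) 0)).
  + apply/eqP; rewrite -(dir00 R) => /dir_inj [e _]; move: l0; rewrite e; lra.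
  + exact: n.
  + exact/cone_chart.
  + exact/cone_chart.
  + have := @chord R false l 0 f 0 _ i2 c0.1.
    rewrite /sg expr0 el e0 (_ : f + 2^-1 = (2 * f + 1) / 2); last by lra.
    exact.
  + have := @chord R false l 0 _ 0 _ i2 D.
    rewrite /sg expr0 el e0 (_ : (2 * f + 1) / 2 + 2^-1 = f + 1); last by lra.
    by apply; exact: c1.1.
Qed.

End Horizontal.

(** * Tree words *)

Section Words.
Variable R : realType.
Local Notation f := (phi R).
Implicit Types (k : 'I_4) (a : seq 'I_4) (J K : 'I_5) (v : 'cV[R]_2).

Lemma conjPM (M N : 'M[R]_2) : conjP (M *m N) = conjP M *m conjP N.
Proof.
by rewrite /conjP !mulmxA (mulmxKV (matP_unit R)).
Qed.

Lemma fate_rot K J v : v != 0 -> fate K v (side_midpoint R J) ->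
  conjP (rot_mx R) *m v != 0 /\
  fate K (conjP (rot_mx R) *m v) (side_midpoint R (rot_side J)).
Proof.
move=> v0 h; split; last exact: fate_image (rot_iso R) v0 (rot_rel_midpoint R J) h.
apply: contra v0 => /eqP e.
by rewrite -(mulKmx (iso_unit (rot_iso R)) v) e mulmx0.
Qed.

Lemma fate_twist K J v : v != 0 -> fate K v (side_midpoint R J) ->
  conjP (shear_mx R 1) *m v != 0 /\
  fate K (conjP (shear_mx R 1) *m v) (side_midpoint R (twist_side J)).
Proof.
move=> v0 h; split; last exact: fate_image (twist_iso R 1) v0 (twist_rel_midpoint R J) h.
apply: contra v0 => /eqP e.
by rewrite -(mulKmx (iso_unit (twist_iso R 1)) v) e mulmx0.
Qed.

(** The four sectors of the tree are the images under the twist of four successive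
    rotates of the first one. *)
Lemma sigma_twist_rot k : sigma R k = shear_mx R 1 *m iter k (mulmx (rot_mx R)) 1%:M.
Proof.
have p2 := phi_sq R.
have p3 : f * f * f = 2 * f + 1 by rewrite p2 mulrDl p2; lra.
have p4 : f * f * f * f = 3 * f + 2 by rewrite p3 mulrDl -mulrA p2; lra.
case: k => -[|[|[|[|//]]]] i; rewrite /sigma /= ?mulmx1 /rot_mx /shear_mx ?mx2_mul;
  congr mx2; lra.
Qed.

Lemma tperm_lbl (i j m : nat) : (0 < i <= 5)%N -> (0 < j <= 5)%N -> (0 < m <= 5)%N ->
  tperm (lbl i) (lbl j) (lbl m) = lbl (if m == i then j else if m == j then i else m).
Proof.
move=> /andP[i0 i5] /andP[j0 j5] /andP[m0 m5].
have lblE u w : (0 < u <= 5)%N -> (0 < w <= 5)%N -> (lbl u == lbl w) = (u == w).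
  case: u w => [//|u] [//|w] hu hw; rewrite -val_eqE /lbl !valK5 //=.
rewrite permE /= !lblE ?m0 ?i0 ?j0 //; by case: ifP => // _; case: ifP.
Qed.

Lemma tau_sides k J :
  twist_side (iter k rot_side (tau k J)) = J.
Proof.
case: k => -[|[|[|[|//]]]] i; elim/ord5_ind: J; rewrite /tau permM !tperm_lbl //=.
all: by rewrite ?rot_sideE ?twist_sideE.
Qed.

Lemma fate_sigma K J k v : v != 0 ->
  fate K v (side_midpoint R (tau k J)) ->
  conjP (sigma R k) *m v != 0 /\ fate K (conjP (sigma R k) *m v) (side_midpoint R J).
Proof.
move=> v0 h; rewrite sigma_twist_rot conjPM -mulmxA -[X in side_midpoint R X](tau_sides k).
have [w0 h'] : conjP (iter k (mulmx (rot_mx R)) 1%:M) *m v != 0 /\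
    fate K (conjP (iter k (mulmx (rot_mx R)) 1%:M) *m v)
      (side_midpoint R (iter k rot_side (tau k J))).
  elim: (nat_of_ord k) => [|n [IH0 IH]] /=.
    by rewrite /conjP mulmx1 mulmxV ?matP_unit // mul1mx.
  by rewrite conjPM -mulmxA; apply: fate_rot.
exact: fate_twist.
Qed.

(** The last letter is the last matrix applied to the direction and the first
    permutation applied to the label. *)
Lemma tau_word_rcons a k J : tau_word (rcons a k) J = tau_word a (tau k J).
Proof.
suff -> : tau_word (rcons a k) = (tau k * tau_word a)%g by rewrite permM.
rewrite /tau_word foldr_rcons mul1g.
elim: a => [|k' a IH] /=; first by rewrite mulg1.
by rewrite IH mulgA.
Qed.

Lemma tree_vector_fate a J l : 0 < l ->
  l *: (matP R *m tree_vector R a) != 0 /\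
  fate (tau_word a J) (l *: (matP R *m tree_vector R a)) (side_midpoint R J).
Proof.
move=> l0; elim/last_ind: a J => [|a k IH] J.
  rewrite /tree_vector /= -/(dir 1 0) dirZ mulr1 mulr0 perm1; split.
    by apply/eqP; rewrite -(dir00 R) => /dir_inj [e _]; move: l0; rewrite e ltxx.
  exact: horizontal_fate.
have -> : l *: (matP R *m tree_vector R (rcons a k)) =
    conjP (sigma R k) *m (l *: (matP R *m tree_vector R a)).
  rewrite /tree_vector foldl_rcons -scalemxAr /conjP -!mulmxA.
  by rewrite (mulKmx (matP_unit R)).
rewrite tau_word_rcons; have [v0 h] := IH (tau k J).
exact: fate_sigma.
Qed.

End Words.

Theorem theorem1p1 (R : realType) (v : 'cV[R]_2) (J : 'I_5) (a : seq 'I_4) :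
  periodic_direction v ->
  tree_word a (invmx (matP R) *m v) ->
  [/\ tau_word a J \in [:: lbl 1; lbl 2] ->
        short_trajectory v (side_midpoint R J),
      tau_word a J \in [:: lbl 3; lbl 4] ->
        long_trajectory v (side_midpoint R J) &
      tau_word a J = lbl 5 ->
        saddle_trajectory v (side_midpoint R J)].
Proof.
move=> _ [l l0 e]; have -> : v = l *: (matP R *m tree_vector R a).
  by rewrite scalemxAr -e (mulKVmx (matP_unit R)).
exact: (tree_vector_fate a J l0).2.
Qed.
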